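(* Let $E_n = I\,[n,0]$ and $O_n = I\,[n,0]'$, $n\in\mathbb{Z}$, be the $I$-orbits in the affine flag variety $\mathrm{SL}_2((t))/I$ of $\mathrm{SL}_2$ over $\mathbb{C}$, and let $I_2\supset I_4$ be the subgroups of $I$ given in the context. For $n>0$ let $E_n^{\mathrm{o}},E_n^{\mathrm{h}}$, and for $n\ge 0$ let $O_n^{\mathrm{o}},O_n^{\mathrm{h}}$, be the subsets defined in the context. Then: (1) For $n>0$, each of $E_n^{\mathrm{o}}$ and $E_n^{\mathrm{h}}$ is an $I_2$-orbit. (2) $O_n^{\mathrm{o}}$ for $n\geq 0$, and $O_n^{\mathrm{h}}$ for $n>0$, is an $I_2$-orbit. (3) For $n<0$, $E_n$ decomposes (as a disjoint union) into the $I_2$-orbits $$E_n^{\mathrm{o}} := [-n-1, \mathbb{C}^{\times}t^n+\mathbb{C} t^{n+1}+\dots +\mathbb{C} t^{-n-1}]' \cong \mathbb{G}_m \times \mathbb{A}^{-2n-1},$$ $$E_n^{\mathrm{h}} := \Big(\bigsqcup_{k=1}^{-2n-1}[-n-1-k,\ \mathbb{C}^{\times} t^n + \mathbb{C} t^{n+1}+\dots + \mathbb{C} t^{-n-1-k}]'\Big)\sqcup \{[n,0]\}\cong \mathbb{A}^{-2n-1}.$$ In fact, $I_4\,[-n-1,t^n]' \supseteq E_n^{\mathrm{o}}$ and $I_4\,[n,0] \supseteq E_n^{\mathrm{h}}$. (4) For $n<0$, $O_n$ decomposes (as a disjoint union) into the $I_2$-orbits $$O_n^{\mathrm{o}} :=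 [-n-1, \mathbb{C}^{\times}t^n+\mathbb{C} t^{n+1}+\dots+\mathbb{C} t^{-n-2}] \cong \mathbb{G}_m \times \mathbb{A}^{-2n-2},$$ $$O_n^{\mathrm{h}} := \Big(\bigsqcup_{k=1}^{-2n-2}[-n-1-k,\ \mathbb{C}^{\times}t^n +\mathbb{C} t^{n+1}+\dots + \mathbb{C} t^{-n-2-k}]\Big)\sqcup \{[n,0]'\} \cong \mathbb{A}^{-2n-2}.$$ In fact, $I_4\,[-n-1,t^n] \supseteq O_n^{\mathrm{o}}$ and $I_4\,[n,0]' \supseteq O_n^{\mathrm{h}}$.
   Context: Everything is over $\mathbb{C}$, and only $\mathbb{C}$-points are considered. $\mathrm{SL}_2((t))$ is the group of $2\times 2$ matrices with entries in $\mathbb{C}((t))$ and determinant $1$. The standard Iwahori subgroup is $$I = \left\{\begin{pmatrix} a & b \\ tc & d\end{pmatrix} : a,b,c,d \in \mathbb{C}[[t]],\ ad-tbc = 1\right\}.$$ The quotient $\mathrm{SL}_2((t))/I$ is the affine flag variety (an ind-variety); $\mathrm{SL}_2((t))$ and its subgroups act on it by left multiplication. The following are subgroups of $I$: $$I_2 = \left\{\begin{pmatrix} a & tb \\ t^2c & d\end{pmatrix} : a,b,c,d \in \mathbb{C}[[t]],\ ad-t^3bc = 1\right\},$$ $$I_4 = \left\{\begin{pmatrix} \alpha(1+t^2a) & t^2b \\ t^2c & \alpha^{-1}(1+t^2d)\end{pmatrix} : \alpha \in \mathbb{C}^{\times},\ a, b, c, d \in \mathbb{C}[[t]],\ a+d+t^2(ad-bc)=0\right\}.$$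 For $n\in\mathbb{Z}$ and $p\in\mathbb{C}[t,t^{-1}]$ that is $0$ or of degree (largest exponent) $<n$, write $[n,p]$ for the coset $\begin{pmatrix} t^n & p \\ 0 & t^{-n}\end{pmatrix}I$. For $n\in\mathbb{Z}$ and $p\in\mathbb{C}[t,t^{-1}]$ that is $0$ or of degree $\le n$, write $[n,p]'$ for the coset $\begin{pmatrix} p & t^n \\ -t^{-n} & 0\end{pmatrix}I$. Every element of $\mathrm{SL}_2((t))/I$ is of exactly one of these two forms, for unique $n$ and $p$. For a set $S$ of Laurent polynomials, $[n,S]=\{[n,p]:p\in S\}$ and $[n,S]'=\{[n,p]':p\in S\}$. An expression $\mathbb{C} t^{i}+\dots+\mathbb{C} t^{j}$ denotes the span of $t^i,\dots,t^j$ (equal to $\{0\}$ if $j<i$), and $\mathbb{C}^\times t^i+\mathbb{C}t^{i+1}+\dots+\mathbb{C}t^j$ (with $j\ge i$) denotes the set of $\sum_{m=i}^j p_m t^m$ with $p_i\neq 0$. An empty union is empty. $\mathbb{A}^d$ is affine $d$-space and $\mathbb{G}_m=\mathbb{A}^1\setminus\{0\}$. Definitions for nonnegative indices: for $n>0$, $$E_n^{\mathrm{o}} := [n, \mathbb{C}^{\times} t^{-n}+\mathbb{C} t^{-n+1}+\dots + \mathbb{C} t^{n-1}],\qquad E_n^{\mathrm{h}} := [n, \mathbb{C} t^{-n+1}+\mathbb{C} t^{-n+2}+\dots + \mathbb{C} t^{n-1}],$$ and for $n\ge 0$, $$O_n^{\mathrm{o}} := [n,\mathbb{C}^{\times} t^{-n}+\mathbb{C}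 t^{-n+1}+\dots + \mathbb{C} t^n]',\qquad O_n^{\mathrm{h}} := [n, \mathbb{C} t^{-n+1}+ \mathbb{C} t^{-n+2}+\dots + \mathbb{C} t^n]'.$$ *)

(* Defs.v *)
From HB Require Import structures.
From mathcomp Require Import all_boot all_order all_algebra.
From mathcomp Require Import boolp classical_sets fsbigop reals complex.
From mathcomp Require Import mpoly.
From mathcomp Require Import zify.

Set Implicit Arguments.
Unset Strict Implicit.
Unset Printing Implicit Defensive.

Import Order.TTheory GRing.Theory Num.Theory.
Local Open Scope classical_set_scope.
Local Open Scope ring_scope.

(** * Formal Laurent series *)

Record laurent (F : comNzRingType) := Laurent {
  lcoef : int -> F;
  lcoefP : exists N : int, forall n, n < N -> lcoef n = 0
}.

Section LaurentRing.
Variable F : comNzRingType.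
Implicit Types f g h : laurent F.

Lemma laurentP f g : lcoef f =1 lcoef g -> f = g.
Proof.
case: f g => [f Hf] [g Hg] /= /funext fg.
by subst g; congr Laurent; apply: Prop_irrelevance.
Qed.

HB.instance Definition _ := gen_eqMixin (laurent F).
HB.instance Definition _ := gen_choiceMixin (laurent F).

Lemma lzero_subproof : exists N : int, forall n, n < N -> (0 : F) = 0.
Proof. by exists 0. Qed.
Definition lzero := Laurent lzero_subproof.

Lemma lopp_subproof f : exists N : int, forall n, n < N -> - lcoef f n = 0.
Proof.
by have [N HN] := lcoefP f; exists N => n /HN ->; rewrite oppr0.
Qed.
Definition lopp f := Laurent (lopp_subproof f).

Lemma ladd_subproof f g :
  exists N : int, forall n, n < N -> lcoef f n + lcoef g n = 0.
Proof.
have [N HN] := lcoefP f; have [M HM] := lcoefP g; exists (Num.min N M) => n.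
by rewrite lt_min => /andP[/HN -> /HM ->]; rewrite addr0.
Qed.
Definition ladd f g := Laurent (ladd_subproof f g).

(* The sum has finite support, because both factors vanish in low degrees. *)
Definition lmul_coef f g (n : int) : F :=
  \sum_(i \in [set: int]) lcoef f i * lcoef g (n - i).

Lemma lmul_coefE f g (a b n : int) (K : nat) :
    (forall i, i < a -> lcoef f i = 0) -> (forall i, i < b -> lcoef g i = 0) ->
    n - a - b < K%:Z ->
  lmul_coef f g n = \sum_(k < K) lcoef f (a + k%:Z) * lcoef g (n - a - k%:Z).
Proof.
move=> fa gb nK; rewrite /lmul_coef (fsbigE [seq a + k%:Z | k <- iota 0 K]).
- under eq_bigl => i do rewrite in_setT.
  rewrite big_map -{1}[K]subn0 -/(index_iota 0 K) big_mkord.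
  by apply: eq_bigr => k _; rewrite opprD addrA.
- by rewrite map_inj_uniq ?iota_uniq // => i j /addrI[].
- by [].
move=> i _ iK; have [ia|ai] := ltP i a; first by rewrite fa ?mul0r.
rewrite gb ?mulr0 //; apply: contraNlt iK => big.
have /gez0_abs ak : 0 <= i - a by rewrite subr_ge0.
apply/mapP; exists `|i - a|%N; last by rewrite ak addrC subrK.
rewrite mem_iota add0n -ltz_nat ak; apply: le_lt_trans nK.
by lia.
Qed.

Lemma lmul_subproof f g : exists N : int, forall n, n < N -> lmul_coef f g n = 0.
Proof.
have [a fa] := lcoefP f; have [b gb] := lcoefP g; exists (a + b) => n nab.
rewrite (@lmul_coefE f g a b n 0) ?big_ord0 //.
by rewrite -addrA -opprD subr_lt0.
Qed.
Definition lmul f g := Laurent (lmul_subproof f g).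

Lemma lmono_subproof (c : F) (m : int) :
  exists N : int, forall n, n < N -> (if n == m then c else 0) = 0.
Proof. by exists m => n; case: eqP => // ->; rewrite ltxx. Qed.
(* The monomial c t^m. *)
Definition lmono (c : F) (m : int) := Laurent (lmono_subproof c m).

Lemma laddA : associative ladd.
Proof. by move=> f g h; apply: laurentP => n /=; rewrite addrA. Qed.
Lemma laddC : commutative ladd.
Proof. by move=> f g; apply: laurentP => n /=; rewrite addrC. Qed.
Lemma ladd0 : left_id lzero ladd.
Proof. by move=> f; apply: laurentP => n /=; rewrite add0r. Qed.
Lemma laddN : left_inverse lzero lopp ladd.
Proof. by move=> f; apply: laurentP => n /=; rewrite addNr. Qed.

HB.instance Definition _ :=
  GRing.isZmodule.Build (laurent F) laddA laddC ladd0 laddN.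

(* Above a common lower bound for the exponents, coefficients of products are
   coefficients of products of polynomials. *)
Let trunc f (a : int) (K : nat) : {poly F} :=
  \poly_(k < K) lcoef f (a + k%:Z).

Lemma lmul_trunc f g (a b : int) (k K : nat) :
    (forall i, i < a -> lcoef f i = 0) -> (forall i, i < b -> lcoef g i = 0) ->
    (k < K)%N ->
  lcoef (lmul f g) (a + b + k%:Z) = (trunc f a K * trunc g b K)`_k.
Proof.
move=> fa gb kK; rewrite /= (@lmul_coefE f g a b _ k.+1) //; last first.
  by rewrite -addrA -opprD addrAC subrr add0r ltz_nat.
rewrite coefM; apply: eq_bigr => -[j /= jk] _.
rewrite !coef_poly (leq_ltn_trans _ kK) // (leq_ltn_trans (leq_subr _ _) kK).
by congr (_ * lcoef g _); lia.
Qed.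

Lemma lmul_low f g (a b : int) :
    (forall i, i < a -> lcoef f i = 0) -> (forall i, i < b -> lcoef g i = 0) ->
  forall n, n < a + b -> lcoef (lmul f g) n = 0.
Proof.
move=> fa gb n nab; rewrite /= (@lmul_coefE f g a b n 0) ?big_ord0 //.
by rewrite -addrA -opprD subr_lt0.
Qed.

Lemma trunc_mul f g (a b : int) (k K : nat) :
    (forall i, i < a -> lcoef f i = 0) -> (forall i, i < b -> lcoef g i = 0) ->
    (k < K)%N ->
  (trunc (lmul f g) (a + b) K)`_k = (trunc f a K * trunc g b K)`_k.
Proof. by move=> fa gb kK; rewrite coef_poly kK (lmul_trunc fa gb kK). Qed.

Lemma int_lowP (a n : int) : n < a \/ exists k : nat, n = a + k%:Z.
Proof.
have [na|an] := ltP n a; [by left | right; exists `|n - a|%N].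
by lia.
Qed.

Lemma lmulC : commutative lmul.
Proof.
move=> f g; apply: laurentP => n.
have [a fa] := lcoefP f; have [b gb] := lcoefP g.
have [nab|[k ->]] := int_lowP (a + b) n.
  by rewrite (lmul_low fa gb nab) (lmul_low gb fa) // addrC.
rewrite (lmul_trunc fa gb (ltnSn k)) [a + b]addrC (lmul_trunc gb fa (ltnSn k)).
by rewrite mulrC.
Qed.

Lemma lmulA : associative lmul.
Proof.
move=> f g h; apply: laurentP => n.
have [a fa] := lcoefP f; have [b gb] := lcoefP g; have [c hc] := lcoefP h.
have fg := lmul_low fa gb; have gh := lmul_low gb hc.
have [nabc|[k ->]] := int_lowP (a + (b + c)) n.
  by rewrite (lmul_low fa gh nabc) (lmul_low fg hc) // -addrA.
rewrite (lmul_trunc fa gh (ltnSn k)) addrA (lmul_trunc fg hc (ltnSn k)).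
transitivity (trunc f a k.+1 * (trunc g b k.+1 * trunc h c k.+1))`_k.
  rewrite !coefM; apply: eq_bigr => -[j /= jk] _.
  by rewrite trunc_mul // ltnS leq_subr.
rewrite mulrA !coefM; apply: eq_bigr => -[j /= jk] _.
by rewrite trunc_mul.
Qed.

Definition lone := lmono 1 0.

Lemma lmul1 : left_id lone lmul.
Proof.
move=> f; apply: laurentP => n; have [a fa] := lcoefP f.
have one0 i : i < 0 -> lcoef lone i = 0 by rewrite /=; case: eqP => // ->.
have [na|[k ->]] := int_lowP a n.
  by rewrite (lmul_low one0 fa) ?add0r // fa.
rewrite /= (@lmul_coefE _ _ 0 a _ k.+1) //; last first.
  by rewrite subr0 addrAC subrr add0r ltz_nat.
rewrite big_ord_recl big1 ?addr0 /= => [|i _].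
  by rewrite mul1r; congr lcoef; lia.
by rewrite mul0r.
Qed.

Lemma lmulDl : left_distributive lmul ladd.
Proof.
move=> f g h; apply: laurentP => n.
have [a fa] := lcoefP f; have [b gb] := lcoefP g; have [c hc] := lcoefP h.
pose m := Num.min a b.
have fm i : i < m -> lcoef f i = 0 by rewrite lt_min => /andP[/fa].
have gm i : i < m -> lcoef g i = 0 by rewrite lt_min => /andP[_ /gb].
have fgm i : i < m -> lcoef (ladd f g) i = 0.
  by move=> im /=; rewrite fm ?gm ?addr0.
have nK : n - m - c < (`|(n - m - c)%R|%N.+1)%:Z by lia.
rewrite [LHS](lmul_coefE fgm hc nK) /= (lmul_coefE fm hc nK).
by rewrite (lmul_coefE gm hc nK) -big_split; apply: eq_bigr => i _; rewrite mulrDl.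
Qed.

Lemma lone_neq0 : lone != 0.
Proof.
apply/eqP => /(congr1 (fun f => lcoef f 0)) /= /eqP.
by rewrite oner_eq0.
Qed.

HB.instance Definition _ := GRing.Zmodule_isComNzRing.Build (laurent F)
  lmulA lmulC lmul1 lmulDl lone_neq0.

End LaurentRing.

Section AffineFlag.
Variable F : fieldType.
Local Notation L := (laurent F).
Local Notation M2 := 'M[laurent F]_2.

(** * SL_2((t)), its subgroups and the affine flag variety *)

Definition tpow (n : int) : L := lmono 1 n.
Definition lconst (c : F) : L := lmono c 0.

Definition power_series : set L := [set f | forall n, n < 0 -> lcoef f n = 0].

Definition mx2 (a b c d : L) : M2 :=
  \matrix_(i, j) if i == 0 then (if j == 0 then a else b)
                           else (if j == 0 then c else d).

Definition SL2 : set M2 := [set g | \det g = 1].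

Definition Iwahori : set M2 :=
  [set g | exists a b c d : L,
     [/\ power_series a, power_series b, power_series c & power_series d] /\
     a * d - tpow 1 * b * c = 1 /\
     g = mx2 a b (tpow 1 * c) d].

Definition I2 : set M2 :=
  [set g | exists a b c d : L,
     [/\ power_series a, power_series b, power_series c & power_series d] /\
     a * d - tpow 3 * b * c = 1 /\
     g = mx2 a (tpow 1 * b) (tpow 2 * c) d].

Definition I4 : set M2 :=
  [set g | exists (alpha : F) (a b c d : L),
     alpha != 0 /\
     [/\ power_series a, power_series b, power_series c & power_series d] /\
     a + d + tpow 2 * (a * d - b * c) = 0 /\
     g = mx2 (lconst alpha * (1 + tpow 2 * a)) (tpow 2 * b)
             (tpow 2 * c) (lconst alpha^-1 * (1 + tpow 2 * d))].

(* Points of SL_2((t))/I are represented by the cosets gI as sets of matrices. *)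
Definition coset (g : M2) : set M2 := [set g *m h | h in Iwahori].

Definition affine_flag : set (set M2) := [set coset g | g in SL2].

Definition flag_act (g : M2) (x : set M2) : set M2 := [set g *m h | h in x].

Definition flag_orbit (H : set M2) (x : set M2) : set (set M2) :=
  [set flag_act g x | g in H].

Definition is_orbit (H : set M2) (S : set (set M2)) : Prop :=
  exists2 x, affine_flag x & S = flag_orbit H x.

(* [ptE n p] is [n, p] and [ptO n p] is [n, p]'. *)
Definition ptE (n : int) (p : L) : set M2 :=
  coset (mx2 (tpow n) p 0 (tpow (- n))).
Definition ptO (n : int) (p : L) : set M2 :=
  coset (mx2 p (tpow n) (- tpow (- n)) 0).

(* C t^i + ... + C t^j, which is {0} when j < i. *)
Definition lspan (i j : int) : set L :=
  [set p | forall m, ~~ (i <= m <= j) -> lcoef p m = 0].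
(* C^x t^i + C t^(i+1) + ... + C t^j, used only for i <= j. *)
Definition lspan_unit (i j : int) : set L :=
  [set p | lspan i j p /\ lcoef p i != 0].

Definition E_ (n : int) : set (set M2) := flag_orbit Iwahori (ptE n 0).
Definition O_ (n : int) : set (set M2) := flag_orbit Iwahori (ptO n 0).

(* The suffixes o and h are those of E_n^o, E_n^h, O_n^o, O_n^h; [_pos] is the
   definition for n > 0 (n >= 0 for O), [_neg] the one for n < 0. *)
Definition Eo_pos (n : int) := ptE n @` lspan_unit (- n) (n - 1).
Definition Eh_pos (n : int) := ptE n @` lspan (- n + 1) (n - 1).
Definition Oo_pos (n : int) := ptO n @` lspan_unit (- n) n.
Definition Oh_pos (n : int) := ptO n @` lspan (- n + 1) n.

Definition Eo_neg (n : int) := ptO (- n - 1) @` lspan_unit n (- n - 1).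
Definition Oo_neg (n : int) := ptE (- n - 1) @` lspan_unit n (- n - 2).

Definition Eh_range (n : int) : set int := [set k | 1 <= k <= -2 * n - 1].
Definition Eh_stratum (n k : int) :=
  ptO (- n - 1 - k) @` lspan_unit n (- n - 1 - k).
Definition Eh_neg (n : int) : set (set M2) :=
  (\bigcup_(k in Eh_range n) Eh_stratum n k) `|` [set ptE n 0].

Definition Oh_range (n : int) : set int := [set k | 1 <= k <= -2 * n - 2].
Definition Oh_stratum (n k : int) :=
  ptE (- n - 1 - k) @` lspan_unit n (- n - 2 - k).
Definition Oh_neg (n : int) : set (set M2) :=
  (\bigcup_(k in Oh_range n) Oh_stratum n k) `|` [set ptO n 0].

(** * Quasi-affine varieties (closed points) *)

Definition zariski_closed m (Z : set 'rV[F]_m) : Prop :=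
  exists P : set {mpoly F[m]}, Z = [set x | forall p, P p -> p.@[x ord0] = 0].

Definition quasi_affine m (W : set 'rV[F]_m) : Prop :=
  exists Z1 Z2, [/\ zariski_closed Z1, zariski_closed Z2 & W = Z1 `\` Z2].

Definition basic_open m (b : {mpoly F[m]}) : set 'rV[F]_m :=
  [set x | b.@[x ord0] != 0].

Definition regular_fun m (W : set 'rV[F]_m) (f : 'rV[F]_m -> F) : Prop :=
  forall x, W x -> exists a b : {mpoly F[m]}, basic_open b x /\
    forall y, (W `&` basic_open b) y -> f y = a.@[y ord0] / b.@[y ord0].

Definition regular_map m k (W : set 'rV[F]_m) (f : 'rV[F]_m -> 'rV[F]_k) :=
  forall j, regular_fun W (fun x => f x ord0 j).

Definition affine_space d : set 'rV[F]_d := setT.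
(* G_m x A^d inside A^1 x A^d. *)
Definition Gm_affine_space d : set 'rV[F]_(1 + d) :=
  [set x | x ord0 (lshift d ord0) != 0].

(** * The ind-variety structure on SL_2((t))/I *)

(* A morphism from a quasi-affine variety W to SL_2((t))/I: Zariski-locally on
   W it is given by a W-point of SL_2((t)), that is, by a matrix of determinant
   1 of Laurent series with uniformly bounded pole order whose coefficients are
   regular functions. (On reduced test schemes the affine flag variety is the
   Zariski sheafification of R |-> SL_2(R((t)))/I(R), because SL_2((t)) ->
   SL_2((t))/I is Zariski-locally trivial.) *)
Definition morphism_to_flag m (W : set 'rV[F]_m) (phi : 'rV[F]_m -> set M2) :=
  forall x, W x -> exists (b : {mpoly F[m]}) (g : 'rV[F]_m -> M2) (N : int),
    let U := W `&` basic_open b in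
    [/\ basic_open b x,
        forall y, U y -> SL2 (g y) /\ phi y = coset (g y),
        forall y i j n, U y -> n < N -> lcoef (g y i j) n = 0
      & forall i j n, regular_fun U (fun y => lcoef (g y i j) n)].

(* The ind-variety is exhausted by projective varieties, which are covered by
   affine ones; hence closedness and regularity can be tested on morphisms
   from quasi-affine varieties. *)
Definition flag_closed (Z : set (set M2)) : Prop :=
  Z `<=` affine_flag /\
  forall m (W : set 'rV[F]_m) phi, quasi_affine W -> morphism_to_flag W phi ->
    exists2 Z', zariski_closed Z' & W `&` phi @^-1` Z = W `&` Z'.

Definition flag_locally_closed (X : set (set M2)) : Prop :=
  exists Z1 Z2, [/\ flag_closed Z1, flag_closed Z2 & X = Z1 `\` Z2].

(* A morphism from the locally closed subset X, with its reduced structure, to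
   A^k. *)
Definition morphism_from_flag k (X : set (set M2)) (xi : set M2 -> 'rV[F]_k) :=
  forall m (W : set 'rV[F]_m) phi, quasi_affine W -> morphism_to_flag W phi ->
    phi @` W `<=` X -> regular_map W (xi \o phi).

(* X is a locally closed subvariety isomorphic to the quasi-affine variety V. *)
Definition flag_isomorphic k (X : set (set M2)) (V : set 'rV[F]_k) : Prop :=
  flag_locally_closed X /\
  exists (phi : 'rV[F]_k -> set M2) (xi : set M2 -> 'rV[F]_k),
    [/\ morphism_to_flag V phi, morphism_from_flag X xi,
        forall v, V v -> X (phi v) /\ xi (phi v) = v
      & forall x, X x -> V (xi x) /\ phi (xi x) = x].

End AffineFlag.

Arguments affine_space : clear implicits.
Arguments Gm_affine_space : clear implicits.
Arguments Iwahori : clear implicits.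
Arguments I2 : clear implicits.
Arguments I4 : clear implicits.
Arguments E_ : clear implicits.
Arguments O_ : clear implicits.
Arguments Eo_pos : clear implicits.
Arguments Eh_pos : clear implicits.
Arguments Oo_pos : clear implicits.
Arguments Oh_pos : clear implicits.
Arguments Eo_neg : clear implicits.
Arguments Eh_neg : clear implicits.
Arguments Oo_neg : clear implicits.
Arguments Oh_neg : clear implicits.
Arguments Eh_stratum : clear implicits.
Arguments Oh_stratum : clear implicits.

(* Main.v *)
Require Import Defs.
From HB Require Import structures.
From mathcomp Require Import all_boot all_order all_algebra.
From mathcomp Require Import boolp classical_sets fsbigop reals complex.
From mathcomp Require Import mpoly.
From mathcomp Require Import zify ring.

Set Implicit Arguments.
Unset Strict Implicit.
Unset Printing Implicit Defensive.

Import Order.TTheory GRing.Theory Num.Theory.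
Local Open Scope classical_set_scope.
Local Open Scope ring_scope.

(** The cosets [[n, p]] and [[n, p]'] are two views of the same picture, so both
    are treated at once with a boolean [j] ([false] for [E_n], [true] for
    [O_n]).  For [n < 0] the base matrix [diag(t^n, t^-n)], or its antidiagonal
    analogue, has a column of least order, column [dcol j], and the orbit of its
    coset under the Iwahori group is parametrised by the direction of the line
    spanned by that column: every coset in the orbit is

      [chart j n c = (1 0; t c 1) . base j n . I],   with [c] a power series.

    The key lemma [coset_chartP] says that a matrix with column [(w1, w2)] of the
    right orders represents [chart j n c] exactly when [w2 - t c w1] has order at
    least [n + 1 + width j n]; hence [c] is determined exactly modulo
    [t^(width j n)], where [width j n] is [-2n] for [E_n] and [-2n - 1] for
    [O_n].  Everything about negative indices is read off this parameter [c].

    - The point of the other kind with indices [- n - 1 - k] and [p] has parameter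
      [-t^(n + k) / p] or [t^(n + k) / p], so these points, for [p] with lowest
      term in [t^n], are exactly the charts with [c] of order [k] ([stratumE]).
      Thus the open part is the locus [c_0 <> 0], the closed part is the locus
      [c_0 = 0], and the latter is stratified by the order of [c].
    - An element of [I_2] with diagonal [(a, d)] multiplies [c_0] by
      [d_0 / a_0], so both loci are stable ([I2_chart]).  Conversely the lower
      triangular elements of [I_4] act by [c |-> alpha^-2 c + e] with [e] an arbitrary
      series of positive order, which is transitive on each locus because every scalar is a
      square ([I4_chart]).
    - The coefficients [c_0, ..., c_(width - 1)] are the coordinates giving the
      isomorphisms.  They are regular, since [w2 = t c w1] can be solved for them
      recursively, dividing only by the leading coefficient of [w1]
      ([regular_chart_coef]).  Local closedness holds because, among matrices
      whose entries satisfy the obvious order bounds, the orbit is the locus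
      where the leading coefficient of [w1] is nonzero, and inside it [c_0 = 0] is
      the vanishing of the product of the leading coefficients of [w1] and [w2]
      ([chart_locally_closed]).

    For positive indices, conjugation by [(0 1; t 0)] preserves [I] and [I_2] and
    maps the two loci for a negative index to the two sets in question for a
    nonnegative index ([flip_chart]), so that the orbit statements carry over. *)

(** * Orders of Laurent series *)

Section LaurentOrder.
Variable F : fieldType.
Local Notation L := (laurent F).
Local Notation tpow := (tpow F).
Implicit Types (f g : L) (a b n k : int).

(** The fractional ideal [t^a F[[t]]]; for [a = 0] it is convertible to
    [power_series]. *)
Definition ord_ge a : set L := [set f | forall n, n < a -> lcoef f n = 0].

Lemma lcoefD f g n : lcoef (f + g) n = lcoef f n + lcoef g n.
Proof. by []. Qed.
Lemma lcoefN f n : lcoef (- f) n = - lcoef f n.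
Proof. by []. Qed.
Lemma lcoefB f g n : lcoef (f - g) n = lcoef f n - lcoef g n.
Proof. by []. Qed.
Lemma lcoef0 n : lcoef (0 : L) n = 0.
Proof. by []. Qed.
Lemma lcoef1 n : lcoef (1 : L) n = (n == 0)%:R.
Proof. by rewrite /= /lone /lmono /=; case: eqP. Qed.
Lemma lcoef_tpow a n : lcoef (tpow a) n = (n == a)%:R.
Proof. by rewrite /=; case: eqP. Qed.
Lemma lcoef_lconst (c : F) n : lcoef (lconst c) n = if n == 0 then c else 0.
Proof. by []. Qed.

Lemma lcoef_mul f g a b n (K : nat) :
    ord_ge a f -> ord_ge b g -> n - a - b < K%:Z ->
  lcoef (f * g) n = \sum_(k < K) lcoef f (a + k%:Z) * lcoef g (n - a - k%:Z).
Proof. exact: lmul_coefE. Qed.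

Lemma ord_geW a b f : b <= a -> ord_ge a f -> ord_ge b f.
Proof. by move=> ba fa n nb; apply: fa; apply: lt_le_trans ba. Qed.
Lemma ord_ge0 a : ord_ge a 0. Proof. by []. Qed.
Lemma ord_geD a f g : ord_ge a f -> ord_ge a g -> ord_ge a (f + g).
Proof. by move=> fa ga n na; rewrite lcoefD fa ?ga ?addr0. Qed.
Lemma ord_geN a f : ord_ge a f -> ord_ge a (- f).
Proof. by move=> fa n na; rewrite lcoefN fa ?oppr0. Qed.
Lemma ord_geB a f g : ord_ge a f -> ord_ge a g -> ord_ge a (f - g).
Proof. by move=> fa ga; apply: ord_geD => //; apply: ord_geN. Qed.
Lemma ord_geM a b f g : ord_ge a f -> ord_ge b g -> ord_ge (a + b) (f * g).
Proof. by move=> fa gb; apply: lmul_low. Qed.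
Lemma ord_ge_tpow a : ord_ge a (tpow a).
Proof. by move=> n na; rewrite lcoef_tpow lt_eqF. Qed.
Lemma ord_ge1 : ord_ge 0 1.
Proof. by move=> n na; rewrite lcoef1 lt_eqF. Qed.
Lemma ord_ge_lconst (c : F) : ord_ge 0 (lconst c).
Proof. by move=> n na; rewrite lcoef_lconst lt_eqF. Qed.

Lemma ord_geMx a b c f g :
  ord_ge a f -> ord_ge b g -> c <= a + b -> ord_ge c (f * g).
Proof. by move=> fa gb ca; apply: ord_geW ca (ord_geM fa gb). Qed.

(** The coefficient at the sum of the two order bounds has a single term. *)
Lemma lcoefM_low a b n f g : n = a + b -> ord_ge a f -> ord_ge b g ->
  lcoef (f * g) n = lcoef f a * lcoef g b.
Proof.
move=> -> fa gb; rewrite (@lcoef_mul f g a b _ 1) //; last by lia.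
by rewrite big_ord1 addr0 subr0 [a + b]addrC addrK.
Qed.

Lemma lcoef_tpowM a f n : lcoef (tpow a * f) n = lcoef f (n - a).
Proof.
have [b fb] := lcoefP f.
have [na|an] := ltP (n - a) b.
  rewrite fb //; apply: (ord_geM (@ord_ge_tpow a) fb).
  by lia.
rewrite (@lcoef_mul _ _ a b _ (`|(n - a - b)%R|%N.+1)) //.
- rewrite big_ord_recl addr0 lcoef_tpow eqxx mul1r subr0 big1 ?addr0 // => i _.
  by rewrite lcoef_tpow gt_eqF ?mul0r // ltrDl.
- exact: ord_ge_tpow.
- by lia.
Qed.

Lemma tpowD a b : tpow (a + b) = tpow a * tpow b.
Proof.
by apply: laurentP => n; rewrite lcoef_tpowM !lcoef_tpow subr_eq [b + a]addrC.
Qed.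
Lemma tpow0 : tpow 0 = 1. Proof. by []. Qed.
Lemma tpowK a : tpow a * tpow (- a) = 1.
Proof. by rewrite -tpowD subrr. Qed.

Lemma ord_ge_tpowM a b f : ord_ge b (tpow a * f) <-> ord_ge (b - a) f.
Proof.
split=> H n nb.
  have := H (n + a); rewrite lcoef_tpowM addrK; apply; lia.
by rewrite lcoef_tpowM H //; lia.
Qed.

Lemma lconstM (c d : F) : lconst c * lconst d = lconst (c * d) :> L.
Proof.
apply: laurentP => n; have [n0|n0] := ltP n 0.
  by rewrite (ord_geM (@ord_ge_lconst c) (@ord_ge_lconst d)) ?lcoef_lconst ?lt_eqF.
rewrite (@lcoef_mul _ _ 0 0 _ (`|n|.+1)%N); [|exact: ord_ge_lconst..|by lia].
rewrite big_ord_recl big1 ?addr0 => [|i _].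
  by rewrite !lcoef_lconst eqxx; case: eqP; rewrite ?mulr0.
by rewrite lcoef_lconst mul0r.
Qed.

Lemma ltrunc_subproof a f :
  exists N : int, forall n, n < N -> (if n < a then lcoef f n else 0) = 0.
Proof. by have [N fN] := lcoefP f; exists N => n /fN ->; case: ifP. Qed.
Definition ltrunc a f : L := Laurent (ltrunc_subproof a f).

Lemma lcoef_ltrunc a f n : lcoef (ltrunc a f) n = if n < a then lcoef f n else 0.
Proof. by []. Qed.
Lemma ltrunc_sub a f : ord_ge a (f - ltrunc a f).
Proof. by move=> n na; rewrite lcoefB lcoef_ltrunc na subrr. Qed.
Lemma ord_ge_ltrunc a b f : ord_ge b f -> ord_ge b (ltrunc a f).
Proof. by move=> fb n nb; rewrite lcoef_ltrunc fb // if_same. Qed.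

(** The geometric series: modulo [t^K] only the powers [x^i] with [i < K]
    contribute to the sum, so its [k]-th coefficient may be read off the
    partial sum of length [k + 1]. *)
Lemma geometric_inverse (x : L) :
  ord_ge 1 x -> exists2 g, ord_ge 0 g & (1 - x) * g = 1.
Proof.
move=> x1.
have xX (i : nat) : ord_ge i (x ^+ i).
  elim: i => [|i IH]; first exact: ord_ge1.
  by rewrite exprS; apply: ord_geMx x1 IH _; lia.
pose S (K : nat) : L := \sum_(i < K) x ^+ i.
have S0 K : ord_ge 0 (S K).
  rewrite /S; elim/big_ind: _ => [||i _]; [exact: ord_ge0|exact: ord_geD|].
  by apply: ord_geW (xX i).
have stable (k K : nat) : (k < K)%N -> lcoef (S K) k = lcoef (S k.+1) k.
  elim: K => // K IH; rewrite ltnS leq_eqVlt => /orP[/eqP-> //|kK].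
  by rewrite /S big_ord_recr lcoefD -/(S K) IH // [lcoef (x ^+ K) _]xX ?addr0 ?ltz_nat.
have gP : exists N : int, forall n, n < N ->
    (if n is Posz k then lcoef (S k.+1) k else 0) = 0.
  by exists 0 => -[].
pose g : L := Laurent gP.
have gS (K : nat) : ord_ge K (g - S K).
  move=> [k|k] nK; rewrite lcoefB /=; last by rewrite (S0 K) ?subr0.
  by rewrite [in X in _ - X]stable ?subrr.
exists g; first by case.
apply/subr0_eq/laurentP => n; rewrite lcoef0.
suff H : ord_ge (`|n|.+1)%N ((1 - x) * g - 1) by apply: H; lia.
set K := (`|n|.+1)%N; have eS : (1 - x) * S K = 1 - x ^+ K.
  by rewrite -[1 - x]opprB mulNr -subrX1 opprB.
rewrite (_ : _ - _ = (1 - x) * (g - S K) - x ^+ K); last first.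
  by rewrite mulrBr eS; ring.
have x0 : ord_ge 0 (1 - x) by apply: ord_geB ord_ge1 (ord_geW _ x1).
by apply: ord_geB (xX K); apply: ord_geMx x0 (gS K) _; rewrite add0r.
Qed.

(** After normalising the leading term to [1], the series is [1 - x] with [x] of
    positive order. *)
Lemma laurent_inverse f n : ord_ge n f -> lcoef f n != 0 ->
  exists g, [/\ ord_ge (- n) g, lcoef g (- n) != 0 & f * g = 1].
Proof.
move=> fn fn0; set c := lcoef f n in fn0 *.
pose x : L := 1 - lconst c^-1 * (tpow (- n) * f).
have y0 : ord_ge 0 (tpow (- n) * f).
  by apply/ord_ge_tpowM; rewrite opprK add0r.
have x1 : ord_ge 1 x.
  move=> k k1; rewrite lcoefB; have [k0|k0] := ltP k 0.
    rewrite lcoef1 lt_eqF // (ord_geM (@ord_ge_lconst _) y0) ?subr0 //.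
  have -> : k = 0 by lia.
  rewrite (@lcoefM_low 0 0) //; last exact: ord_ge_lconst.
  by rewrite lcoef_tpowM lcoef1 eqxx opprK add0r lcoef_lconst eqxx mulVf ?subrr.
have [g g0 g1] := geometric_inverse x1.
pose h := lconst c^-1 * (tpow (- n) * g).
have hn : ord_ge (- n) h.
  have gn : ord_ge (- n) (tpow (- n) * g) by apply/ord_ge_tpowM; rewrite subrr.
  by apply: ord_geMx (@ord_ge_lconst _) gn _; rewrite add0r.
have fh : f * h = 1.
  by rewrite -g1 /h /x; ring.
exists h; split=> //; apply/eqP => h0.
have := @lcoefM_low n (- n) 0 f h; rewrite subrr fh h0 mulr0 lcoef1 eqxx.
by move=> /(_ erefl fn hn) /eqP; rewrite oner_eq0.
Qed.

End LaurentOrder.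

(** * Matrices, cosets and orbits *)

Section Cosets.
Variable F : fieldType.
Local Notation L := (laurent F).
Local Notation M2 := 'M[laurent F]_2.
Local Notation tpow := (tpow F).
Implicit Types (g h : M2) (a b c d : L) (H : set M2) (x y : set M2).

Lemma ord2P (P : 'I_2 -> Prop) : P 0 -> P 1 -> forall i, P i.
Proof.
move=> P0 P1 [[|[|//]] i2]; [have -> // : Ordinal i2 = 0|have -> // : Ordinal i2 = 1];
by apply: val_inj.
Qed.

Lemma mx2E00 a b c d : mx2 a b c d 0 0 = a. Proof. by rewrite mxE. Qed.
Lemma mx2E01 a b c d : mx2 a b c d 0 1 = b. Proof. by rewrite mxE. Qed.
Lemma mx2E10 a b c d : mx2 a b c d 1 0 = c. Proof. by rewrite mxE. Qed.
Lemma mx2E11 a b c d : mx2 a b c d 1 1 = d. Proof. by rewrite mxE. Qed.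
Definition mx2E := (mx2E00, mx2E01, mx2E10, mx2E11).

Lemma mx2_eta g : g = mx2 (g 0 0) (g 0 1) (g 1 0) (g 1 1).
Proof. by apply/matrixP; apply: ord2P; apply: ord2P; rewrite mx2E. Qed.

Lemma mx2P g : exists a b c d, g = mx2 a b c d.
Proof.
by exists (g 0 0), (g 0 1), (g 1 0), (g 1 1); apply: mx2_eta.
Qed.

Lemma mul_mx2 a b c d a' b' c' d' :
  mx2 a b c d *m mx2 a' b' c' d' =
  mx2 (a * a' + b * c') (a * b' + b * d') (c * a' + d * c') (c * b' + d * d').
Proof.
by apply/matrixP; apply: ord2P; apply: ord2P;
  rewrite mx2E mxE big_ord_recl big_ord1 (_ : lift 0 0 = 1) ?mx2E //; apply: val_inj.
Qed.

Lemma det_mx2 a b c d : \det (mx2 a b c d) = a * d - b * c.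
Proof.
rewrite (expand_det_row _ 0) big_ord_recl big_ord1 (_ : lift 0 0 = 1); last first.
  exact: val_inj.
rewrite !mx2E /cofactor !det_mx11 !mxE /= expr0 expr1 mul1r mulN1r mulrN.
by rewrite /lift /=.
Qed.

Lemma mx2_1 : mx2 1 0 0 1 = 1%:M :> M2.
Proof. by apply/matrixP; apply: ord2P; apply: ord2P; rewrite !mxE. Qed.

Definition adj2 g : M2 := mx2 (g 1 1) (- g 0 1) (- g 1 0) (g 0 0).

Lemma mul_adj2 g : SL2 g -> adj2 g *m g = 1%:M.
Proof.
have [a [b [c [d ->]]]] := mx2P g; rewrite /SL2 /= det_mx2 => gdet.
by rewrite /adj2 !mx2E mul_mx2 -mx2_1; congr mx2; rewrite -?gdet; ring.
Qed.
Lemma mul_mxadj2 g : SL2 g -> g *m adj2 g = 1%:M.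
Proof.
have [a [b [c [d ->]]]] := mx2P g; rewrite /SL2 /= det_mx2 => gdet.
by rewrite /adj2 !mx2E mul_mx2 -mx2_1; congr mx2; rewrite -?gdet; ring.
Qed.
Lemma det_adj2 g : \det (adj2 g) = \det g.
Proof.
by have [a [b [c [d ->]]]] := mx2P g; rewrite /adj2 !mx2E !det_mx2; ring.
Qed.

Lemma SL2M g h : SL2 g -> SL2 h -> SL2 (g *m h).
Proof. by rewrite /SL2 /= det_mulmx => -> ->; rewrite mulr1. Qed.

Lemma shift_entry (k : int) c : ord_ge k c -> exists2 c', power_series c' & c = tpow k * c'.
Proof.
move=> ck; exists (tpow (- k) * c); last by rewrite mulrA tpowK mul1r.
by apply/ord_ge_tpowM; rewrite opprK add0r.
Qed.
Lemma ord_ge_shift (k : int) c : power_series c -> ord_ge k (tpow k * c).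
Proof. by move=> c0; apply/ord_ge_tpowM; rewrite subrr. Qed.

Lemma IwahoriP g : Iwahori F g <-> SL2 g /\
  [/\ ord_ge 0 (g 0 0), ord_ge 0 (g 0 1), ord_ge 1 (g 1 0) & ord_ge 0 (g 1 1)].
Proof.
split=> [[a [b [c [d [[a0 b0 c0 d0] [gdet ->]]]]]]|].
  rewrite /SL2 /= det_mx2 !mx2E; split; first by rewrite -gdet; ring.
  by split=> //; apply: ord_ge_shift.
have [a [b [c [d ->]]]] := mx2P g; rewrite /SL2 /= det_mx2 !mx2E.
move=> [gdet [a0 b0 /(@shift_entry 1)[c' c0 ec] d0]].
by exists a, b, c', d; do 2![split=> //]; rewrite -?gdet ec //; ring.
Qed.

Lemma I2P g : I2 F g <-> SL2 g /\
  [/\ ord_ge 0 (g 0 0), ord_ge 1 (g 0 1), ord_ge 2 (g 1 0) & ord_ge 0 (g 1 1)].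
Proof.
have t3 : tpow 3 = tpow 1 * tpow 2 by rewrite -tpowD.
split=> [[a [b [c [d [[a0 b0 c0 d0] [gdet ->]]]]]]|].
  rewrite /SL2 /= det_mx2 !mx2E; split; first by rewrite -gdet t3; ring.
  by split=> //; apply: ord_ge_shift.
have [a [b [c [d ->]]]] := mx2P g; rewrite /SL2 /= det_mx2 !mx2E.
move=> [gdet [a0 /(@shift_entry 1)[b' b0 eb] /(@shift_entry 2)[c' c0 ec] d0]].
exists a, b', c', d; do 2![split=> //]; last by rewrite eb ec.
by rewrite -gdet eb ec t3; ring.
Qed.

Lemma I4_sub_I2 : I4 F `<=` I2 F.
Proof.
move=> _ [al [a [b [c [d [al0 [[a0 b0 c0 d0] [e ->]]]]]]]].
have t2 f : power_series f -> ord_ge 2 (tpow 2 * f) by move=> ?; apply: (@ord_ge_shift 2).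
have unit_ge f (e0 : F) : power_series f -> ord_ge 0 (lconst e0 * (1 + tpow 2 * f)).
  move=> f0; apply: ord_geMx (@ord_ge_lconst _ e0) (_ : ord_ge 0 _) _ => //.
  by apply: ord_geD; [exact: ord_ge1|apply: ord_geW (t2 _ f0)].
apply/I2P; rewrite !mx2E /SL2 /= det_mx2; split; last first.
  by split; [exact: unit_ge|apply: ord_geW (t2 _ b0)|exact: t2|exact: unit_ge].
have ee : lconst al * lconst al^-1 = 1 by rewrite lconstM divff.
transitivity (lconst al * lconst al^-1 *
   (1 + tpow 2 * (a + d + tpow 2 * (a * d - b * c)))
   + (lconst al * lconst al^-1 - 1) * (tpow 2 * b * (tpow 2 * c))); first by ring.
by rewrite ee e mulr0 subrr addr0 mul0r mulr1 addr0.
Qed.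

Lemma I2_sub_Iwahori : I2 F `<=` Iwahori F.
Proof.
move=> g /I2P[gdet [a0 b0 c0 d0]]; apply/IwahoriP; split=> //.
by split=> //; [apply: ord_geW b0|apply: ord_geW c0].
Qed.

Lemma IwahoriM g h : Iwahori F g -> Iwahori F h -> Iwahori F (g *m h).
Proof.
move=> /IwahoriP[gdet [a0 b0 c0 d0]] /IwahoriP[hdet [a0' b0' c0' d0']].
apply/IwahoriP; split; first exact: SL2M.
rewrite [g]mx2_eta [h]mx2_eta mul_mx2 !mx2E.
by split; apply: ord_geD; apply: ord_geMx; eauto.
Qed.

Lemma Iwahori_adj2 g : Iwahori F g -> Iwahori F (adj2 g).
Proof.
move=> /IwahoriP[gdet [a0 b0 c0 d0]]; apply/IwahoriP.
by rewrite /SL2 /= det_adj2 /adj2 !mx2E; split=> //; split=> //; apply: ord_geN.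
Qed.

Lemma Iwahori1 : Iwahori F 1%:M.
Proof.
apply/IwahoriP; rewrite -mx2_1 /SL2 /= det_mx2 !mx2E; split.
  by rewrite mulr1 mulr0 subr0.
by split=> //; apply: ord_ge1.
Qed.

Lemma coset_self g : coset g g.
Proof. by exists 1%:M; [exact: Iwahori1|rewrite mulmx1]. Qed.

Lemma coset_mulr g h : Iwahori F h -> coset (g *m h) = coset g.
Proof.
move=> hI; have /IwahoriP[hdet _] := hI.
apply/seteqP; split=> _ [k kI <-].
  by exists (h *m k); [exact: IwahoriM|rewrite mulmxA].
exists (adj2 h *m k); first by apply: IwahoriM kI; apply: Iwahori_adj2.
by rewrite -mulmxA (mulmxA h) mul_mxadj2 // mul1mx.
Qed.

Lemma coset_eqP g g' : SL2 g' -> coset g = coset g' <-> Iwahori F (adj2 g' *m g).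
Proof.
move=> g'det; split=> [gg'|gI].
  have := coset_self g; rewrite gg' => -[h hI <-].
  by rewrite mulmxA mul_adj2 // mul1mx.
by rewrite -(coset_mulr g' gI) mulmxA mul_mxadj2 // mul1mx.
Qed.

Lemma flag_act_coset h g : flag_act h (coset g) = coset (h *m g).
Proof.
by rewrite /flag_act /coset image_comp; apply: eq_imagel => k _ /=; rewrite mulmxA.
Qed.

Lemma flag_orbit_cosetP H g y :
  flag_orbit H (coset g) y <-> exists2 h, H h & y = coset (h *m g).
Proof.
by split=> [[h Hh <-]|[h Hh ->]]; exists h => //; rewrite flag_act_coset.
Qed.

End Cosets.

(** * Charts on the orbits of negative index *)

Section Charts.
Variable F : fieldType.
Local Notation L := (laurent F).
Local Notation M2 := 'M[laurent F]_2.
Local Notation tpow := (tpow F).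
Implicit Types (g h : M2) (c p : L) (j : bool) (n k : int).

Definition pt j n p : set M2 := if j then ptO n p else ptE n p.

Definition base j n : M2 :=
  if j then mx2 0 (tpow n) (- tpow (- n)) 0 else mx2 (tpow n) 0 0 (tpow (- n)).

Definition lower c : M2 := mx2 1 0 c 1.

Definition chart j n c : set M2 := coset (lower (tpow 1 * c) *m base j n).

(** The dimension of the orbit of [pt j n 0], for [n < 0]. *)
Definition width j n : int := - 2 * n - j%:Z.

(** For [n < 0], the column of [base j n] containing the entry of least order [n];
    its direction is what determines a coset in the orbit. *)
Definition dcol j : 'I_2 := if j then 1 else 0.

(** Membership in [t^n] times the Iwahori order, shifted by [(0 1; t 0)] when [j]
    holds.  The condition is stable under the Iwahori group on both sides and cuts
    out a finite-dimensional closed union of orbits in which the orbit of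
    [base j n] is open. *)
Definition bounded j n g :=
  [/\ ord_ge n (g 0 (dcol j)), ord_ge (n + 1) (g 1 (dcol j)),
      ord_ge (n + j%:Z) (g 0 (dcol (~~ j))) & ord_ge (n + j%:Z) (g 1 (dcol (~~ j)))].

(** The coefficients of lowest possible order in the two entries of column
    [dcol j]: the orbit is the locus [lead != 0], and there [slope / lead] is the
    constant coefficient of the chart parameter. *)
Definition lead j n g : F := lcoef (g 0 (dcol j)) n.
Definition slope j n g : F := lcoef (g 1 (dcol j)) (n + 1).

Lemma pt0 j n : pt j n 0 = coset (base j n).
Proof. by case: j. Qed.

Lemma SL2_base j n : SL2 (base j n).
Proof.
by case: j; rewrite /SL2 /= det_mx2 ?mulr0 ?sub0r ?mulrN ?opprK ?subr0 tpowK.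
Qed.
Lemma SL2_lower c : SL2 (lower c).
Proof. by rewrite /SL2 /= det_mx2; ring. Qed.

Lemma chart0 j n : chart j n 0 = pt j n 0.
Proof. by rewrite pt0 /chart /lower mulr0 mx2_1 mul1mx. Qed.

Lemma SL2_chart j n c : SL2 (lower c *m base j n).
Proof. by apply: SL2M; [exact: SL2_lower|exact: SL2_base]. Qed.

Lemma Iwahori_lower c : ord_ge 0 c -> Iwahori F (lower (tpow 1 * c)).
Proof.
move=> c0; apply/IwahoriP; split; first exact: SL2_lower.
by rewrite /lower !mx2E; split=> //; [exact: ord_ge1|exact: ord_ge_shift|exact: ord_ge1].
Qed.

Lemma bounded_mull j n h g : Iwahori F h -> bounded j n g ->
  bounded j n (h *m g) /\ lead j n (h *m g) = lcoef (h 0 0) 0 * lead j n g.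
Proof.
move=> /IwahoriP[_ [a0 b0 c0 d0]]; rewrite [g]mx2_eta [h in h *m _]mx2_eta mul_mx2.
case: j; rewrite /bounded /lead /= !mx2E => -[w1 w2 x1 x2];
  (split; first by split; apply: ord_geD;
     (eapply ord_geMx; [eassumption|eassumption|lia])).
  rewrite lcoefD (lcoefM_low _ a0 w1) ?add0r //.
  by rewrite [X in _ + X](ord_geM b0 w2) ?addr0 //; lia.
rewrite lcoefD (lcoefM_low _ a0 w1) ?add0r //.
by rewrite [X in _ + X](ord_geM b0 w2) ?addr0 //; lia.
Qed.

Lemma bounded_mulr j n g h : Iwahori F h -> bounded j n g ->
  bounded j n (g *m h) /\ lead j n (g *m h) = lcoef (h (dcol j) (dcol j)) 0 * lead j n g.
Proof.
move=> /IwahoriP[_ [a0 b0 c0 d0]]; rewrite [g]mx2_eta [h in _ *m h]mx2_eta mul_mx2.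
case: j; rewrite /bounded /lead /= !mx2E => -[w1 w2 x1 x2];
  (split; first by split; apply: ord_geD;
     (eapply ord_geMx; [eassumption|eassumption|lia])).
  rewrite lcoefD (lcoefM_low _ w1 d0) ?addr0 // [RHS]mulrC.
  by rewrite [X in X + _](ord_geM x1 b0) ?add0r //; lia.
rewrite lcoefD (lcoefM_low _ w1 a0) ?addr0 // [RHS]mulrC.
by rewrite [X in _ + X](ord_geM x1 c0) ?addr0 //; lia.
Qed.

Lemma slope_mull j n h g : I2 F h -> bounded j n g ->
  slope j n (h *m g) = lcoef (h 1 1) 0 * slope j n g.
Proof.
move=> /I2P[_ [a0 b0 c0 d0]]; rewrite [g]mx2_eta [h in h *m _]mx2_eta mul_mx2.
rewrite /bounded /slope; case: j; rewrite /= !mx2E => -[w1 w2 _ _];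
rewrite lcoefD (lcoefM_low _ d0 w2) ?add0r //;
by rewrite [X in X + _](ord_geM c0 w1) ?add0r //; lia.
Qed.

Lemma Iwahori_diag h : Iwahori F h ->
  lcoef (h 0 0) 0 != 0 /\ lcoef (h 1 1) 0 != 0.
Proof.
move=> /IwahoriP[]; rewrite /SL2 /= {1}[h]mx2_eta det_mx2 => hdet [a0 b0 c1 d0].
have := congr1 (fun f => lcoef f 0) hdet.
rewrite lcoefB (lcoefM_low _ a0 d0) // [X in _ - X](ord_geM b0 c1) // subr0 lcoef1 eqxx.
by move=> e; split; apply/eqP => e0; move/eqP: e; rewrite e0 ?mul0r ?mulr0 eq_sym oner_eq0.
Qed.

Lemma lower_baseE j n c : lower c *m base j n =
  if j then mx2 0 (tpow n) (- tpow (- n)) (c * tpow n)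
  else mx2 (tpow n) 0 (c * tpow n) (tpow (- n)).
Proof. by case: j; rewrite /lower /base mul_mx2; congr mx2; ring. Qed.

Lemma lower_base_col j n c :
  (lower c *m base j n) 0 (dcol j) = tpow n /\
  (lower c *m base j n) 1 (dcol j) = c * tpow n.
Proof. by rewrite lower_baseE; case: j; rewrite !mx2E. Qed.

Lemma bounded_base j n : n < 0 -> bounded j n (base j n) /\ lead j n (base j n) = 1.
Proof.
rewrite /bounded /lead => n0; case: j; rewrite /= !mx2E lcoef_tpow eqxx; split=> //;
  split=> //; try exact: ord_ge_tpow; try exact: ord_ge0.
  by apply: ord_geN; apply: ord_geW (@ord_ge_tpow _ _); lia.
by apply: ord_geW (@ord_ge_tpow _ _); lia.
Qed.

Lemma bounded_lower_base j n c : n < 0 -> ord_ge 0 c ->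
  bounded j n (lower (tpow 1 * c) *m base j n) /\
  lead j n (lower (tpow 1 * c) *m base j n) = 1.
Proof.
move=> n0 c0; have [bb bl] := bounded_base j n0.
have [gb ->] := bounded_mull (Iwahori_lower c0) bb; split=> //.
by rewrite bl /lower mx2E lcoef1 mulr1.
Qed.

(** Used to get the order of one diagonal entry from that of the other one and the
    determinant. *)
Lemma ord_ge_unit (u v e : L) : ord_ge 0 u -> lcoef u 0 != 0 -> ord_ge 0 e ->
  u * v = 1 + e -> ord_ge 0 v.
Proof.
move=> u0 uu e0 uv; have [u' [u'0 _ uu']] := laurent_inverse u0 uu.
rewrite (_ : v = u' * (1 + e)); last by rewrite -uv mulrA [u' * u]mulrC uu' mul1r.
by apply: ord_geMx u'0 (ord_geD (@ord_ge1 _) e0) _.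
Qed.

Lemma adj2_chart_mul j n c g :
  adj2 (lower c *m base j n) *m g =
  let s i := tpow n * (g 1 i - c * g 0 i) in
  let r i := tpow (- n) * g 0 i in
  if j then mx2 (- s 0) (- s 1) (r 0) (r 1) else mx2 (r 0) (r 1) (s 0) (s 1).
Proof.
rewrite [g in LHS]mx2_eta; case: j; rewrite /lower /base mul_mx2 /adj2 !mx2E mul_mx2 /=;
by congr mx2; ring.
Qed.

(** Membership of [base^-1 lower^-1 g] in the Iwahori group is four order
    conditions: the two on the entries of the first row of [g] are implied by
    [bounded], one is the stated condition, and the last one then follows from
    the determinant, as the diagonal entry coming from [lead] is a unit. *)
Lemma coset_chartP j n g c : n < 0 -> SL2 g -> bounded j n g -> lead j n g != 0 ->
  coset g = chart j n c <->
  ord_ge (n + 1 + width j n) (g 1 (dcol j) - tpow 1 * c * g 0 (dcol j)).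
Proof.
move=> n0 gdet gb gl; rewrite coset_eqP ?IwahoriP; last exact: SL2_chart.
have hdet : SL2 (adj2 (lower (tpow 1 * c) *m base j n) *m g).
  by rewrite /SL2 /= det_mulmx det_adj2 SL2_chart gdet mulr1.
have tn f m : ord_ge (m - n) f <-> ord_ge m (tpow n * f) by rewrite ord_ge_tpowM.
have tnn f m : ord_ge (m + n) f -> ord_ge m (tpow (- n) * f).
  by move=> ?; apply/ord_ge_tpowM; rewrite opprK.
move: gb gl hdet; rewrite adj2_chart_mul /bounded /lead /width.
case: j; rewrite /= !mx2E => -[w1 w2 x1 x2] gl; rewrite /SL2 /= det_mx2 => hdet.
  have -> : n + 1 + (- 2 * n - 1) = 0 - n by lia.
  rewrite tn; split=> [[_ [_ /ord_geN h1 _ _]]|H]; first by rewrite opprK in h1.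
  have v0 : ord_ge 0 (tpow (- n) * g 0 1) by apply: tnn; rewrite add0r.
  have v1 : ord_ge 1 (tpow (- n) * g 0 0) by apply: tnn; apply: ord_geW x1; lia.
  split=> //; split=> //; last exact: ord_geN.
  apply: (ord_ge_unit v0) (ord_geMx (ord_geN H) v1 _) _ => //.
    by rewrite lcoef_tpowM opprK add0r.
  by rewrite -[1 in RHS]hdet; ring.
have -> : n + 1 + (- 2 * n - 0) = 1 - n by lia.
rewrite tn; split=> [[_ [_ _ h2 _]]|H] //.
have v0 : ord_ge 0 (tpow (- n) * g 0 0) by apply: tnn; rewrite add0r.
have v1 : ord_ge 0 (tpow (- n) * g 0 1) by apply: tnn; apply: ord_geW x1; lia.
split=> //; split=> //; apply: (ord_ge_unit v0) (ord_geMx H v1 _) _ => //.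
  by rewrite lcoef_tpowM opprK add0r.
by rewrite -[1 in RHS]hdet; ring.
Qed.

Lemma chart_eqP j n c c' : n < 0 -> ord_ge 0 c ->
  chart j n c = chart j n c' <-> ord_ge (width j n) (c - c').
Proof.
move=> n0 c0; have [gb gl] := bounded_lower_base j n0 c0.
rewrite coset_chartP ?gl ?oner_eq0 //; last exact: SL2_chart.
have [-> ->] := lower_base_col j n (tpow 1 * c).
rewrite (_ : _ - _ = tpow (n + 1) * (c - c')); last by rewrite tpowD; ring.
by rewrite ord_ge_tpowM (_ : n + 1 + width j n - (n + 1) = width j n) //; lia.
Qed.

Lemma slope_chart j n g c : n < 0 -> SL2 g -> bounded j n g -> lead j n g != 0 ->
  ord_ge 0 c -> coset g = chart j n c -> slope j n g = lcoef c 0 * lead j n g.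
Proof.
move=> n0 gdet gb gl c0 /coset_chartP => /(_ n0 gdet gb gl) H.
have [w1 w2 _ _] := gb.
have := H (n + 1); rewrite /width lcoefB -mulrA lcoef_tpowM addrK.
rewrite (lcoefM_low _ c0 w1) ?add0r // => H'; apply/eqP; rewrite -subr_eq0.
by apply/eqP/H'; move: n0; case: (j) => /=; lia.
Qed.

(** The chart parameter is the slope [t^-1 w2 / w1] of column [dcol j]. *)
Lemma bounded_chart j n g : n < 0 -> SL2 g -> bounded j n g -> lead j n g != 0 ->
  exists2 c, ord_ge 0 c & coset g = chart j n c.
Proof.
move=> n0 gdet gb gl; have [w1 w2 _ _] := gb.
have [v [v0 _ wv]] := laurent_inverse w1 gl.
exists (tpow (- 1) * (g 1 (dcol j) * v)).
  by apply/ord_ge_tpowM; apply: ord_geMx w2 v0 _; lia.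
apply/coset_chartP => //.
rewrite (_ : _ - _ = g 1 (dcol j) * (1 - (tpow 1 * tpow (- 1)) * (g 0 (dcol j) * v))).
  by rewrite wv tpowK mulr1 subrr mulr0.
by ring.
Qed.

End Charts.

(** * Orbits and strata of negative index *)

Section NegativeOrbits.
Variable F : fieldType.
Local Notation L := (laurent F).
Local Notation M2 := 'M[laurent F]_2.
Local Notation tpow := (tpow F).
Local Notation base := (base F).
Implicit Types (g h : M2) (c p : L) (j : bool) (n k : int).

Definition chart_unit j n k : set (set M2) :=
  chart j n @` [set c | ord_ge k c /\ lcoef c k != 0].

Definition chart_ge j n k : set (set M2) := chart j n @` ord_ge k.

Lemma chart_ge0E j n :
  chart_ge j n 0 = chart_unit j n 0 `|` chart_ge j n 1.
Proof.
apply/seteqP; split=> [_ [c c0 <-]|_ [[c [c0 _] <-]|[c c1 <-]]].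
- have [e|e] := eqVneq (lcoef c 0) 0; [right|left]; exists c => //.
  by move=> m m1; have [/c0//|m0] := ltP m 0; rewrite (_ : m = 0) //; lia.
- by exists c.
- by exists c => //; apply: ord_geW c1.
Qed.

Lemma width_gt0 j n : n < 0 -> 0 < width j n.
Proof. by rewrite /width; case: j => /=; lia. Qed.

Lemma chart_unit_ge_disjoint j n k : n < 0 -> 0 <= k < width j n ->
  chart_unit j n k `&` chart_ge j n (k + 1) = set0.
Proof.
move=> n0 /andP[k0 kw]; apply/seteqP; split=> // _ [[c [c0 ck] <-]] [c' c1].
move/esym/(chart_eqP _ _ n0 (ord_geW k0 c0))/(_ k kw).
rewrite lcoefB (c1 k) ?subr0; last by lia.
by move=> e; rewrite e eqxx in ck.
Qed.

Lemma chart_unit_sub_ge j n k l : l <= k -> chart_unit j n k `<=` chart_ge j n l.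
Proof. by move=> lk _ [c [ck _] <-]; exists c => //; apply: ord_geW ck. Qed.

Lemma chart_width j n c : n < 0 -> ord_ge (width j n) c -> chart j n c = pt j n 0.
Proof.
move=> n0 cw; rewrite -chart0; apply/chart_eqP => //; last by rewrite subr0.
by apply: ord_geW cw; apply/ltW/width_gt0.
Qed.

(** Stratification by the order of the parameter, which only matters below
    [width j n]. *)
Lemma chart_ge_strata j n : n < 0 ->
  chart_ge j n 1 =
  \bigcup_(k in [set k | 1 <= k <= width j n - 1]) chart_unit j n k `|` [set pt j n 0].
Proof.
move=> n0; apply/seteqP; split=> [_ [c c1 <-]|x [[k /andP[k1 kw]]|->]]; first last.
- by exists 0; rewrite ?chart0.
- exact: chart_unit_sub_ge.
have [cw|/existsNP[k /not_implyP[kw ck]]] := pselect (ord_ge (width j n) c).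
  by right; rewrite chart_width.
have [/c1/ck//|k1] := ltP k 1.
(* The stratum is given by the least exponent [i] with a nonzero coefficient. *)
have P0 : exists i : nat, lcoef c i != 0.
  by exists `|k|%N; rewrite gez0_abs; [apply/eqP|lia].
case: (ex_minnP P0) => i ci imin; left.
have ik : (i <= `|k|)%N by apply: imin; rewrite gez0_abs; [apply/eqP|lia].
have ci0 : ord_ge i c.
  move=> [m|m] mi; last by apply: c1.
  by apply/eqP; apply: contraTT mi => /imin; lia.
exists i%:Z; last by exists c.
have [/c1/eqP|i1] := ltP i%:Z 1; first by rewrite (negPf ci).
by apply/andP; split; lia.
Qed.

Lemma orbit_Iwahori j n : n < 0 ->
  flag_orbit (Iwahori F) (pt j n 0) = chart_ge j n 0.
Proof.
move=> n0; apply/seteqP; split=> y; rewrite pt0 flag_orbit_cosetP.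
  move=> [h hI ->]; have [b0 l0] := bounded_base F j n0.
  have [hb hl] := bounded_mull hI b0; have [hd _] := Iwahori_diag hI.
  have hdet : SL2 (h *m base j n) by case/IwahoriP: hI => ? _; apply: SL2M (SL2_base _ _ _).
  case: (bounded_chart n0 hdet hb); first by rewrite hl l0 mulr1.
  by move=> c c0 ->; exists c.
by move=> [c c0 <-]; exists (lower (tpow 1 * c)) => //; apply: Iwahori_lower.
Qed.

(** The off-diagonal entries of an element of [I_2] are too small to affect the
    lowest coefficients of the column, which are only multiplied by units. *)
Lemma I2_chart j n h c : n < 0 -> I2 F h -> ord_ge 0 c ->
  exists c', [/\ ord_ge 0 c', flag_act h (chart j n c) = chart j n c'
    & (lcoef c' 0 == 0) = (lcoef c 0 == 0)].
Proof.
move=> n0 hI2 c0; have hI := I2_sub_Iwahori hI2.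
have [cb cl] := bounded_lower_base j n0 c0.
have [hb hl] := bounded_mull hI cb; have [h0 h1] := Iwahori_diag hI.
have cdet := SL2_chart j n (tpow 1 * c).
have hdet : SL2 (h *m (lower (tpow 1 * c) *m base j n)).
  by case/IwahoriP: hI => ? _; apply: SL2M.
rewrite cl mulr1 in hl; have hl0 := h0; rewrite -hl in hl0.
have [c' c'0 e] := bounded_chart n0 hdet hb hl0.
exists c'; split=> //; first by rewrite flag_act_coset.
have := slope_chart n0 hdet hb hl0 c'0 e; rewrite (slope_mull hI2 cb) hl.
rewrite (slope_chart n0 cdet cb _ c0) // cl ?oner_eq0 // mulr1 => ee.
have := congr1 (fun f => f == 0) ee.
by rewrite !mulf_eq0 (negPf h0) (negPf h1) orbF.
Qed.

(** The matrix [(alpha 0; t^2 r alpha^-1)] maps the parameter [c] to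
    [alpha^-2 c + alpha^-1 t r], so [r] can be solved for as soon as the constant
    coefficients agree. *)
Lemma I4_chart j n (al : F) c c' : n < 0 -> al != 0 -> ord_ge 0 c -> ord_ge 0 c' ->
  lcoef c' 0 * al ^+ 2 = lcoef c 0 ->
  flag_orbit (I4 F) (chart j n c) (chart j n c').
Proof.
move=> n0 al0 c0 c'0 e; apply/flag_orbit_cosetP.
have ala : lconst al * lconst al^-1 = 1 by rewrite lconstM divff.
pose s := lconst al * c' - lconst al^-1 * c.
have s1 : ord_ge 1 s.
  have cc a f : ord_ge 0 f -> ord_ge 0 (lconst a * f).
    by move=> f0; apply: ord_geMx (@ord_ge_lconst _ a) f0 _.
  move=> m m1; have [m0|m0] := ltP m 0; first by apply: ord_geB m0; apply: cc.
  rewrite (_ : m = 0); last by lia.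
  rewrite lcoefB !(@lcoefM_low _ 0 0) ?addr0 //; try exact: ord_ge_lconst.
  by rewrite !lcoef_lconst eqxx -e; field.
(* The lower left entry is [t^2 r = t s], and [s] has positive order by the
   hypothesis on the constant coefficients. *)
pose r := tpow (- 1) * s.
have r0 : power_series r by apply/ord_ge_tpowM.
have tr : tpow 2 * r = tpow 1 * s.
  by rewrite /r mulrA -tpowD.
pose h := mx2 (lconst al * (1 + tpow 2 * 0)) (tpow 2 * 0) (tpow 2 * r)
              (lconst al^-1 * (1 + tpow 2 * 0)).
have hI4 : I4 F h.
  exists al, 0, 0, r, 0; split=> //; split; first by split=> //; apply: ord_ge0.
  by split=> //; ring.
exists h => //; have hI := I2_sub_Iwahori (I4_sub_I2 hI4).
have [cb cl] := bounded_lower_base j n0 c0.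
have [hb hl] := bounded_mull hI cb; have [h0 h1] := Iwahori_diag hI.
apply/esym/coset_chartP => //.
- by case/IwahoriP: hI => ? _; apply: SL2M => //; apply: SL2_chart.
- by rewrite hl cl mulr1.
suff -> : (h *m (lower (tpow 1 * c) *m base j n)) 1 (dcol j) -
  tpow 1 * c' * (h *m (lower (tpow 1 * c) *m base j n)) 0 (dcol j) = 0 by apply: ord_ge0.
rewrite [_ *m base _ _]mx2_eta mul_mx2; have [] := lower_base_col j n (tpow 1 * c).
by case: (j) => /= e0 e1; rewrite !mx2E e0 e1 tr /s; ring.
Qed.

Lemma sqr_scaling (sqrtF : forall x : F, exists y, y ^+ 2 = x) (a b : F) :
  a != 0 -> b != 0 -> exists2 al, al != 0 & b * al ^+ 2 = a.
Proof.
move=> a0 b0; have [al e] := sqrtF (a / b); exists al; last by rewrite e mulrC divfK.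
by rewrite -sqrf_eq0 e mulf_neq0 ?invr_eq0.
Qed.

(** [I_4] is transitive on the locus and [I_2], which contains [I_4], preserves it;
    both inclusions together give the orbit. *)
Lemma chart_unit_orbit (sqrtF : forall x : F, exists y, y ^+ 2 = x) j n c : n < 0 ->
  ord_ge 0 c -> lcoef c 0 != 0 ->
  chart_unit j n 0 `<=` flag_orbit (I4 F) (chart j n c) /\
  chart_unit j n 0 = flag_orbit (I2 F) (chart j n c).
Proof.
move=> n0 c0 ce.
have H : chart_unit j n 0 `<=` flag_orbit (I4 F) (chart j n c).
  move=> _ [c' [c'0 c'e] <-]; have [al al0 e] := sqr_scaling sqrtF ce c'e.
  exact: I4_chart al0 c0 c'0 e.
split=> //; apply/seteqP; split=> [y /H[h hI4 <-]|_ [h hI2 <-]].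
  by exists h => //; apply: I4_sub_I2.
have [c' [c'0 -> e]] := I2_chart j n0 hI2 c0.
by exists c' => //; split=> //; rewrite e.
Qed.

Lemma chart_ge1_orbit j n : n < 0 ->
  chart_ge j n 1 `<=` flag_orbit (I4 F) (pt j n 0) /\
  chart_ge j n 1 = flag_orbit (I2 F) (pt j n 0).
Proof.
move=> n0.
have H : chart_ge j n 1 `<=` flag_orbit (I4 F) (pt j n 0).
  move=> _ [c' c'1 <-]; rewrite -chart0; apply: (@I4_chart _ _ 1) => //.
  - exact: oner_neq0.
  - exact: ord_geW c'1.
  - by rewrite c'1 // mul0r.
split=> //; apply/seteqP; split=> [y /H[h hI4 <-]|_ [h hI2 <-]].
  by exists h => //; apply: I4_sub_I2.
have [c' [c'0 e e0]] := I2_chart j n0 hI2 (@ord_ge0 F 0).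
rewrite -chart0 e; exists c' => //; rewrite lcoef0 eqxx in e0 => m m1.
by have [/c'0//|m0] := ltP m 0; rewrite (_ : m = 0); [apply/eqP|lia].
Qed.

Lemma affine_flag_chart j n c : affine_flag (chart j n c).
Proof. by exists (lower (tpow 1 * c) *m base j n) => //; apply: SL2_chart. Qed.

(** The sign with which [t^(n + 1 + k)] enters column [dcol j] of the
    representative of [pt (~~ j) (- n - 1 - k) p]. *)
Definition sgn j : L := if j then 1 else - 1.

(** Column [dcol j] of the standard representative of the point is
    [(p, sgn j t^(n + 1 + k))], so this is the key lemma [coset_chartP]. *)
Lemma pt_chartP j n k p c : n < 0 -> 0 <= k < width j n ->
  ord_ge n p -> lcoef p n != 0 ->
  pt (~~ j) (- n - 1 - k) p = chart j n c <->
  ord_ge (n + width j n) (sgn j * tpow (n + k) - c * p).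
Proof.
rewrite /width => n0 /andP[k0 kw] pn pl.
pose g : M2 := if j then mx2 (tpow (- n - 1 - k)) p 0 (tpow (n + 1 + k))
  else mx2 p (tpow (- n - 1 - k)) (- tpow (n + 1 + k)) 0.
have -> : pt (~~ j) (- n - 1 - k) p = coset g.
  have e : - (- n - 1 - k) = n + 1 + k by lia.
  by rewrite /g; case: (j) => /=; rewrite /ptE /ptO e.
have gdet : SL2 g.
  rewrite /g /SL2 /=; case: (j); rewrite det_mx2 ?mulr0 ?subr0 ?sub0r ?mulrN ?opprK -tpowD;
  by rewrite (_ : - n - 1 - k + (n + 1 + k) = 0) ?tpow0 //; lia.
have gb : bounded j n g.
  rewrite /bounded /g; case: (j) kw => kw; rewrite /= !mx2E; split=> //;
  do ?[apply: ord_geN]; try (apply: ord_geW (@ord_ge_tpow _ _)); lia.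
have gl : lead j n g != 0 by rewrite /lead /g; case: (j); rewrite /= !mx2E.
rewrite coset_chartP // (_ : _ - _ = tpow 1 * (sgn j * tpow (n + k) - c * p)).
  by rewrite ord_ge_tpowM (_ : n + 1 + width j n - 1 = n + width j n) //; lia.
have e : tpow (n + 1 + k) = tpow 1 * tpow (n + k) by rewrite -tpowD; congr Defs.tpow; lia.
by rewrite /g /sgn; case: (j); rewrite /= !mx2E e; ring.
Qed.

(** The correspondence between [p] and [c] is [c p = sgn j t^(n + k)].  It is enough
    to know [p] modulo [t^(n + width - k)], because [c] has order [k] and only
    matters modulo [t^width]; this is the range of exponents in the statement. *)
Lemma stratumE j n k : n < 0 -> 0 <= k < width j n ->
  pt (~~ j) (- n - 1 - k) @` lspan_unit n (n + width j n - 1 - k) = chart_unit j n k.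
Proof.
move=> n0 kw; have /andP[k0 kw'] := kw.
have sk : ord_ge (n + k) (sgn j * tpow (n + k)).
  rewrite /sgn; case: (j); rewrite ?mulN1r ?mul1r; [|apply: ord_geN]; exact: ord_ge_tpow.
have skl : lcoef (sgn j * tpow (n + k)) (n + k) != 0.
  rewrite /sgn; case: (j); rewrite ?mulN1r ?mul1r ?lcoefN lcoef_tpow eqxx;
    by rewrite ?oppr_eq0 oner_eq0.
apply/seteqP; split=> [_ [p [ps pl] <-]|_ [c [ck cl] <-]].
  have pn : ord_ge n p by move=> m mn; apply: ps; lia.
  have [q [qn ql pq]] := laurent_inverse pn pl.
  have e : n + k + - n = k by lia.
  exists (sgn j * tpow (n + k) * q).
    split; first by apply: ord_geMx sk qn _; rewrite e.
    by rewrite (lcoefM_low _ sk qn) ?mulf_neq0 ?e.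
  apply/esym/pt_chartP => //; rewrite -mulrA [q * p]mulrC pq mulr1 subrr.
  exact: ord_ge0.
have [b [bk bl cb]] := laurent_inverse ck cl.
have e : n + k + - k = n by lia.
pose q := sgn j * tpow (n + k) * b.
have qn : ord_ge n q by apply: ord_geMx sk bk _; rewrite e.
have ql : lcoef q n != 0 by rewrite (lcoefM_low _ sk bk) ?mulf_neq0 ?e.
pose p := ltrunc (n + width j n - k) q.
have pn : ord_ge n p by apply: ord_ge_ltrunc.
have pl : lcoef p n != 0.
  by rewrite lcoef_ltrunc ifT //; lia.
exists p.
  split=> // m; rewrite negb_and -!ltNge => /orP[/pn//|mn].
  by rewrite lcoef_ltrunc ifF //; lia.
apply/pt_chartP => //.
rewrite (_ : _ - _ = c * (q - p)).
  have qp : ord_ge (n + width j n - k) (q - p) by apply: ltrunc_sub.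
  by apply: ord_geMx ck qp _; lia.
by rewrite mulrBr /q mulrA [c * (_ * _)]mulrC -[_ * c * b]mulrA cb mulr1.
Qed.

End NegativeOrbits.

(** * Regular functions and closed subsets of the affine flag variety *)

Section RegularFunctions.
Variables (F : fieldType) (m : nat).
Implicit Types (W : set 'rV[F]_m) (f g : 'rV[F]_m -> F) (b : {mpoly F[m]}).

Lemma regular_ext W f g : regular_fun W f ->
  (forall x, W x -> f x = g x) -> regular_fun W g.
Proof.
move=> rf fg x Wx; have [a [b [bx e]]] := rf x Wx; exists a, b; split=> // y [Wy yb].
by rewrite -fg ?e.
Qed.

Lemma regular_local W f :
  (forall x, W x -> exists2 b, basic_open b x & regular_fun (W `&` basic_open b) f) ->
  regular_fun W f.
Proof.
move=> H x Wx; have [b bx rf] := H x Wx; have [a [c [cx e]]] := rf x (conj Wx bx).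
exists (a * b), (c * b); rewrite /basic_open /= mevalM mulf_neq0 //; split=> // y [Wy].
rewrite /= !mevalM mulf_eq0 negb_or => /andP[yc yb].
by rewrite e // -mulf_div divff // mulr1.
Qed.

Lemma regular_meval W b : regular_fun W (fun x => b.@[x ord0]).
Proof.
move=> x Wx; exists b, 1; rewrite /basic_open /= meval1 oner_neq0; split=> // y _.
by rewrite meval1 divr1.
Qed.

Lemma regular_cst W (c : F) : regular_fun W (fun=> c).
Proof. by apply: regular_ext (regular_meval c%:MP) _ => x _; rewrite mevalC. Qed.

Lemma regularD W f g : regular_fun W f -> regular_fun W g ->
  regular_fun W (fun x => f x + g x).
Proof.
move=> rf rg x Wx; have [a [b [bx e]]] := rf x Wx; have [a' [b' [bx' e']]] := rg x Wx.
exists (a * b' + a' * b), (b * b'); rewrite /basic_open /= mevalM mulf_neq0 //.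
split=> // y [Wy]; rewrite /= !mevalM mulf_eq0 negb_or => /andP[yb yb'].
by rewrite e // e' // mevalD !mevalM addf_div.
Qed.

Lemma regularM W f g : regular_fun W f -> regular_fun W g ->
  regular_fun W (fun x => f x * g x).
Proof.
move=> rf rg x Wx; have [a [b [bx e]]] := rf x Wx; have [a' [b' [bx' e']]] := rg x Wx.
exists (a * a'), (b * b'); rewrite /basic_open /= mevalM mulf_neq0 //.
split=> // y [Wy]; rewrite /= !mevalM mulf_eq0 negb_or => /andP[yb yb'].
by rewrite e // e' // mulf_div.
Qed.

Lemma regularB W f g : regular_fun W f -> regular_fun W g ->
  regular_fun W (fun x => f x - g x).
Proof.
move=> rf rg; apply: regularD rf _.
by apply: regular_ext (regularM (regular_cst (- 1)) rg) _ => x _; rewrite mulN1r.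
Qed.

Lemma regularV W f : (forall x, W x -> f x != 0) -> regular_fun W f ->
  regular_fun W (fun x => (f x)^-1).
Proof.
move=> f0 rf x Wx; have [a [b [bx e]]] := rf x Wx.
have ax : a.@[x ord0] != 0.
  by have := f0 x Wx; rewrite e // mulf_eq0 negb_or => /andP[].
exists (b * b), (a * b); rewrite /basic_open /= mevalM mulf_neq0 //.
split=> // y [Wy]; rewrite /= !mevalM mulf_eq0 negb_or => /andP[ya yb].
by rewrite e // invf_div -mulf_div divff // mulr1.
Qed.

Lemma regular_sum W I (r : seq I) (f : I -> 'rV[F]_m -> F) :
  (forall i, regular_fun W (f i)) -> regular_fun W (fun x => \sum_(i <- r) f i x).
Proof.
move=> rf; elim: r => [|i r IH].
  by apply: regular_ext (regular_cst 0) _ => x _; rewrite big_nil.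
by apply: regular_ext (regularD (rf i) IH) _ => x _; rewrite big_cons.
Qed.

End RegularFunctions.

Section FlagClosed.
Variable F : fieldType.
Local Notation M2 := 'M[laurent F]_2.
Implicit Types (g h : M2) (f : M2 -> F) (Phi : set (M2 -> F)).

Definition coef_fun f := forall m (U : set 'rV[F]_m) (g : 'rV[F]_m -> M2),
  (forall i c n, regular_fun U (fun y => lcoef (g y i c) n)) ->
  regular_fun U (f \o g).

Definition zeros Phi : set M2 := [set g | SL2 g /\ forall f, Phi f -> f g = 0].

(** Locally a morphism to the flag variety lifts to matrices with regular
    coefficients.  The closed set of the base is defined by all polynomials that
    vanish on the preimage; to see that a point [x] outside the preimage is
    excluded, take one of the functions not vanishing at a lift of [x], write it
    as a fraction [a / c] near [x], and multiply [a] by the equations of the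
    complements of the two neighbourhoods involved. *)
Lemma flag_closed_zeros Phi : (forall f, Phi f -> coef_fun f) ->
  (forall g h, zeros Phi g -> Iwahori F h -> zeros Phi (g *m h)) ->
  flag_closed [set coset g | g in zeros Phi].
Proof.
move=> Phic PhiI; set Z := [set _ | _ in _].
have ZP g : Z (coset g) -> zeros Phi g.
  move=> [g' g'Phi e]; have := coset_self g; rewrite -e => -[h hI <-].
  exact: PhiI.
split=> [_ [g [gdet _] <-]|m W phi _ phiM]; first by exists g.
exists [set x | forall p : {mpoly F[m]}, (forall y, W y -> Z (phi y) -> p.@[y ord0] = 0) ->
                p.@[x ord0] = 0].
  by exists [set p : {mpoly F[m]} | forall y, W y -> Z (phi y) -> p.@[y ord0] = 0].
apply/seteqP; split=> x [Wx Zx]; split=> //; first by move=> p; apply.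
have [b [g [N [bx gphi _ greg]]]] := phiM x Wx.
have [gdet phix] := gphi x (conj Wx bx).
apply: contrapT => nZ.
have [f [Phif fx]] : exists f, Phi f /\ f (g x) <> 0.
  apply: contrapT => nf; apply: nZ; rewrite /= phix; exists (g x) => //; split=> // f Phif.
  by apply: contrapT => fx; apply: nf; exists f.
have [a [c [cx e]]] := Phic f Phif _ _ _ greg x (conj Wx bx).
have := Zx (a * (b * c)); rewrite !mevalM => H.
apply: fx; have /= -> := e x (conj (conj Wx bx) cx).
suff /eqP : a.@[x ord0] * (b.@[x ord0] * c.@[x ord0]) = 0.
  by rewrite !mulf_eq0 (negPf bx) (negPf cx) !orbF => /eqP->; rewrite mul0r.
apply: H => y Wy Zy; rewrite !mevalM.
have [->|yb] := eqVneq b.@[y ord0] 0; first by rewrite mul0r mulr0.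
have [->|yc] := eqVneq c.@[y ord0] 0; first by rewrite !mulr0.
have [_ phiy] := gphi y (conj Wy yb).
have [_ /(_ f Phif) fy] : zeros Phi (g y) by apply: ZP; rewrite -phiy.
have /= := e y (conj (conj Wy yb) yc); rewrite fy => /esym/eqP.
by rewrite mulf_eq0 invr_eq0 (negPf yc) orbF => /eqP->; rewrite mul0r.
Qed.

End FlagClosed.

(** * Local closedness and coordinates of the charts *)

Section ChartIsomorphism.
Variable F : fieldType.
Local Notation L := (laurent F).
Local Notation M2 := 'M[laurent F]_2.
Local Notation tpow := (tpow F).
Local Notation base := (base F).
Implicit Types (g h : M2) (c : L) (j : bool) (n : int) (s k : nat).

Definition order_bound j n (i c : 'I_2) : int := if c == dcol j then n + i else n + j.

Lemma boundedP j n g :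
  bounded j n g <-> forall i (c : 'I_2), ord_ge (order_bound j n i c) (g i c).
Proof.
rewrite /bounded /order_bound; split=> [[w1 w2 x1 x2]|H].
  apply: ord2P; apply: ord2P; move: w1 w2 x1 x2; case: j; rewrite /= ?addr0 //=.
have := H 0 (dcol j); have := H 0 (dcol (~~ j)).
have := H 1 (dcol j); have := H 1 (dcol (~~ j)).
by case: (j); rewrite /= ?addr0.
Qed.

Definition bound_coefs j n : set (M2 -> F) :=
  [set f | exists i (c : 'I_2) (k : int),
     k < order_bound j n i c /\ f = fun g => lcoef (g i c) k].

Lemma bound_coefsP j n g :
  (forall f, bound_coefs j n f -> f g = 0) <-> bounded j n g.
Proof.
rewrite boundedP; split=> [H i c k kb|H f [i [c [k [kb ->]]]]]; last exact: H.
by apply: (H (fun g => lcoef (g i c) k)); exists i, c, k.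
Qed.

Lemma coef_fun_bound j n f : bound_coefs j n f -> coef_fun f.
Proof. by move=> [i [c [k [_ ->]]]] m U g; apply. Qed.

Lemma zeros_boundP j n Phi g : zeros (bound_coefs j n `|` Phi) g <->
  [/\ SL2 g, bounded j n g & forall f, Phi f -> f g = 0].
Proof.
split=> [[gdet H]|[gdet /bound_coefsP gb H]].
  by split=> // [|f Pf]; [apply/bound_coefsP => f Pf|]; apply: H; [left|right].
by split=> // f [/gb|/H].
Qed.

Lemma coset_bounded j n g g' : SL2 g -> bounded j n g -> coset g' = coset g ->
  [/\ SL2 g', bounded j n g' & (lead j n g' == 0) = (lead j n g == 0)].
Proof.
move=> gdet gb e; have := coset_self g'; rewrite e => -[h hI <-].
have [hb ->] := bounded_mulr hI gb; split=> //.
  by apply: SL2M => //; case/IwahoriP: hI.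
rewrite mulf_eq0; have [h0 h1] := Iwahori_diag hI.
by case: (j); rewrite /= ?(negPf h0) ?(negPf h1).
Qed.

Lemma chart_unit_coset j n g : n < 0 -> SL2 g -> bounded j n g ->
  lead j n g != 0 -> slope j n g != 0 -> chart_unit j n 0 (coset g).
Proof.
move=> n0 gdet gb gl gs; have [c c0 e] := bounded_chart n0 gdet gb gl.
exists c => //; split=> //; apply: contraNneq gs => c00.
by rewrite (slope_chart n0 gdet gb gl c0 e) c00 mul0r.
Qed.

Lemma chart_bounded j n c g : n < 0 -> ord_ge 0 c -> coset g = chart j n c ->
  [/\ SL2 g, bounded j n g, lead j n g != 0 &
      slope j n g = lcoef c 0 * lead j n g].
Proof.
move=> n0 c0 e; have [cb cl] := bounded_lower_base j n0 c0.
have [gdet gb gl] := coset_bounded (SL2_chart j n (tpow 1 * c)) cb e.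
rewrite cl oner_eq0 in gl; split=> //; first by rewrite gl.
by apply: slope_chart; rewrite ?gl.
Qed.

Definition closed_by j n (f : M2 -> F) : set (set M2) :=
  [set coset g | g in zeros (bound_coefs j n `|` [set f])].

Lemma closed_byP j n f : coef_fun f ->
  (forall g h, SL2 g -> bounded j n g -> Iwahori F h -> f g = 0 -> f (g *m h) = 0) ->
  flag_closed (closed_by j n f) /\
  forall g, closed_by j n f (coset g) <-> [/\ SL2 g, bounded j n g & f g = 0].
Proof.
move=> fc fI.
have zP g : zeros (bound_coefs j n `|` [set f]) g <-> [/\ SL2 g, bounded j n g & f g = 0].
  by rewrite zeros_boundP; split=> [[? ? H]|[? ? H]]; split=> //; [apply: H|move=> _ ->].
have zI g h : zeros (bound_coefs j n `|` [set f]) g -> Iwahori F h ->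
    zeros (bound_coefs j n `|` [set f]) (g *m h).
  move=> /zP[gdet gb fg] hI; apply/zP; have [hb _] := bounded_mulr hI gb.
  by split=> //; [apply: SL2M => //; case/IwahoriP: hI|apply: fI].
split; first by apply: flag_closed_zeros => // f' [/coef_fun_bound//|->].
move=> g; rewrite -zP; split=> [[g' g'z e]|gz]; last by exists g.
by have := coset_self g; rewrite -e => -[h hI <-]; apply: zI.
Qed.

Lemma lead_mulr j n g h : SL2 g -> bounded j n g -> Iwahori F h ->
  lead j n g = 0 -> lead j n (g *m h) = 0.
Proof. by move=> _ gb hI gl; have [_ ->] := bounded_mulr hI gb; rewrite gl mulr0. Qed.

(** Where [lead] is nonzero, [slope] is a multiple of it by a constant that
    depends only on the coset. *)
Lemma lead_slope_mulr j n g h : n < 0 -> SL2 g -> bounded j n g -> Iwahori F h ->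
  lead j n g * slope j n g = 0 -> lead j n (g *m h) * slope j n (g *m h) = 0.
Proof.
move=> n0 gdet gb hI; have [l0|gl] := eqVneq (lead j n g) 0.
  by rewrite lead_mulr // mul0r.
have [c c0 e] := bounded_chart n0 gdet gb gl.
rewrite (slope_chart n0 gdet gb gl c0 e) => /eqP.
rewrite !mulf_eq0 (negPf gl) orbF /= => /eqP c00.
have [|_ _ _ ->] := @chart_bounded j n c (g *m h) n0 c0; first by rewrite coset_mulr.
by rewrite c00 mul0r mulr0.
Qed.

(** The two loci are [{bounded} \ {lead * slope = 0}] and
    [{lead * slope = 0} \ {lead = 0}]. *)
Lemma chart_locally_closed j n : n < 0 ->
  flag_locally_closed (@chart_unit F j n 0) /\ flag_locally_closed (@chart_ge F j n 1).
Proof.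
move=> n0.
have leadc : @coef_fun F (lead j n) by move=> m U g gr; exact: (gr 0 (dcol j) n).
have slopec : @coef_fun F (slope j n) by move=> m U g gr; exact: (gr 1 (dcol j) (n + 1)).
have mulc : @coef_fun F (fun g => lead j n g * slope j n g).
  by move=> m U g gr; apply: regularM (leadc _ _ _ gr) (slopec _ _ _ gr).
have zeroc : @coef_fun F (fun=> 0).
  by move=> m U g gr; apply: regular_cst.
have [cl0 P0] := closed_byP zeroc (fun g h _ _ _ _ => erefl) (j := j) (n := n).
have [cll Pl] := closed_byP leadc (@lead_mulr j n).
have [clm Pm] := closed_byP mulc (fun g h => @lead_slope_mulr j n g h n0).
split.
  exists (closed_by j n (fun=> 0)), (closed_by j n (fun g => lead j n g * slope j n g)).
  split=> //; apply/seteqP; split=> [_ [c [c0 ce] <-]|x [[g] /zeros_boundP[gdet gb _] <-]].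
    have [gdet gb gl gs] :=
    @chart_bounded j n c (lower (tpow 1 * c) *m base j n) n0 c0 erefl.
    split; first exact/P0.
    move=> /Pm[_ _ /eqP]; rewrite mulf_eq0 gs.
    by rewrite mulf_eq0 (negPf gl) (negPf ce).
  move=> nm; have nz : lead j n g * slope j n g != 0.
    by apply/eqP => z; apply: nm; apply/Pm.
  move: nz; rewrite mulf_eq0 negb_or => /andP[gl gs].
  exact: chart_unit_coset.
exists (closed_by j n (fun g => lead j n g * slope j n g)), (closed_by j n (lead j n)).
split=> //; apply/seteqP; split=> [_ [c c1 <-]|x [[g] /zeros_boundP[gdet gb gm] <-]].
  have c0 : ord_ge 0 c by apply: ord_geW c1.
  have [gdet gb gl gs] :=
    @chart_bounded j n c (lower (tpow 1 * c) *m base j n) n0 c0 erefl.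
  split; first by apply/Pm; split=> //; rewrite gs c1 // mul0r mulr0.
  by move=> /Pl[_ _ /eqP]; rewrite (negPf gl).
move=> nl; have gl : lead j n g != 0.
  by apply/eqP => z; apply: nl; apply/Pl.
have [c c0 e] := bounded_chart n0 gdet gb gl.
exists c => // k k1; have [/c0//|k0] := ltP k 0; have -> : k = 0 by lia.
have /eqP := gm _ erefl; rewrite (slope_chart n0 gdet gb gl c0 e).
by rewrite !mulf_eq0 (negPf gl) orbF /= => /eqP.
Qed.

(** The coefficient of [t^(n + 1 + k)] in [w2 = t c w1] reads
    [w2_(n+1+k) = c_k lead + sum_(i < k) c_i w1_(n+k-i)], which gives [c_k] in terms
    of the previous coefficients. *)
Lemma regular_chart_coef j n m (U : set 'rV[F]_m) (g : 'rV[F]_m -> M2)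
    (c : 'rV[F]_m -> L) : n < 0 ->
  (forall i l (r : int), regular_fun U (fun y => lcoef (g y i l) r)) ->
  (forall y, U y -> ord_ge 0 (c y) /\ coset (g y) = chart j n (c y)) ->
  forall k, k%:Z < width j n -> regular_fun U (fun y => lcoef (c y) k).
Proof.
move=> n0 gr gc; elim/ltn_ind => k IH kw.
pose s y := \sum_(i < k) lcoef (c y) i * lcoef (g y 0 (dcol j)) (n + k - i%:Z).
have sr : regular_fun U s.
  apply: regular_sum => i; apply: regularM (gr _ _ _).
  apply: IH => //; apply: lt_trans kw; by rewrite ltz_nat.
have lr : regular_fun U (fun y => (lead j n (g y))^-1).
  apply: regularV (gr _ _ _) => y Uy; have [c0 e] := gc y Uy.
  by have [] := chart_bounded n0 c0 e.
apply: regular_ext (regularM (regularB (gr 1 (dcol j) (n + 1 + k%:Z)) sr) lr) _ => y Uy.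
have [c0 e] := gc y Uy; have [gdet gb gl _] := chart_bounded n0 c0 e.
have /(_ (n + 1 + k%:Z)) := (coset_chartP _ n0 gdet gb gl).1 e.
have [w1 _ _ _] := gb.
rewrite ltrD2l => /(_ kw); rewrite lcoefB -mulrA lcoef_tpowM => /subr0_eq ->.
rewrite (@lcoef_mul _ _ _ 0 n _ k.+1) //; last by lia.
rewrite big_ord_recr /= (_ : \sum_(i < k) _ = s y); last first.
  by apply: eq_bigr => i _; rewrite add0r; congr (_ * lcoef _ _); lia.
by rewrite add0r [s y + _]addrC addrK (_ : n + 1 + k%:Z - 1 - 0 - k%:Z = n) ?mulfK //; lia.
Qed.

Lemma series_subproof s k (v : 'rV[F]_k) : exists N : int, forall r, r < N ->
  \sum_(i < k) (if r == (s + i)%N then v ord0 i else 0) = 0.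
Proof.
by exists 0 => r r0; rewrite big1 // => i _; rewrite ifF //; lia.
Qed.
(** The Laurent polynomial [v_0 t^s + ... + v_(k-1) t^(s + k - 1)]. *)
Definition series s k (v : 'rV[F]_k) : L := Laurent (series_subproof s v).

Lemma series_ge s k (v : 'rV[F]_k) : ord_ge s (series s v).
Proof. by move=> r rs; rewrite /= big1 // => i _; rewrite ifF //; lia. Qed.

Lemma lcoef_series s k (v : 'rV[F]_k) (i : 'I_k) :
  lcoef (series s v) (s + i)%N = v ord0 i.
Proof.
rewrite /= (bigD1 i) //= eqxx big1 ?addr0 // => l li; rewrite ifF //.
by rewrite eqz_nat eqn_add2l eq_sym; apply: contraNF li.
Qed.

Lemma series_row s k c : ord_ge s c ->
  ord_ge (s + k)%N (c - series s (\row_(i < k) lcoef c (s + i)%N)).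
Proof.
move=> cs r rk; rewrite lcoefB; have [rs|rs] := ltP r s.
  by rewrite cs // series_ge // subrr.
have ik : (`|r| - s < k)%N by lia.
rewrite (_ : r = (s + Ordinal ik)%N); last by rewrite /=; lia.
by rewrite lcoef_series mxE subrr.
Qed.

Lemma regular_series s k (V : set 'rV[F]_k) (r : int) :
  regular_fun V (fun v => lcoef (series s v) r).
Proof.
apply: regular_sum => i; case: eqP => _; last exact: regular_cst.
by apply: regular_ext (regular_meval 'X_i) _ => v _; rewrite mevalXU.
Qed.

Lemma morphism_chart j n s k (V : set 'rV[F]_k) : n < 0 ->
  morphism_to_flag V (fun v => chart j n (series s v)).
Proof.
move=> n0 v Vv; exists 1, (fun v => lower (tpow 1 * series s v) *m base j n), n.
have tn : ord_ge n (tpow (- n)) by apply: ord_geW (@ord_ge_tpow _ _); lia.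
have low (v' : 'rV[F]_k) : ord_ge n (tpow 1 * series s v' * tpow n).
  have s0 : ord_ge 0 (series s v') by apply: ord_geW (@series_ge _ _ _); lia.
  have s1 : ord_ge 0 (tpow 1 * series s v') by apply: ord_geMx (@ord_ge_tpow _ 1) s0 _.
  by apply: ord_geMx s1 (@ord_ge_tpow _ n) _; rewrite add0r.
have entry (i l : 'I_2) :
    (exists2 a, ord_ge n a &
       forall y : 'rV[F]_k, (lower (tpow 1 * series s y) *m base j n) i l = a) \/
    (forall y : 'rV[F]_k, (lower (tpow 1 * series s y) *m base j n) i l =
       tpow 1 * series s y * tpow n).
  move: i l; apply: ord2P; apply: ord2P; case: (j);
    try (by right=> y; rewrite lower_baseE mx2E); left;
    eexists; try (by move=> y; rewrite lower_baseE mx2E; reflexivity);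
    first [exact: ord_ge0|exact: ord_ge_tpow|exact: tn|exact: (ord_geN tn)].
split=> [|y _|y i l r _ rn|i l r].
- by rewrite /basic_open /= meval1 oner_neq0.
- by split=> //; apply: SL2_chart.
- by case: (entry i l) => [[a an e]|e]; rewrite e; [exact: an rn|exact: (low y r rn)].
case: (entry i l) => [[a _ e]|e].
  by apply: regular_ext (regular_cst (lcoef a r)) _ => y _; rewrite e.
apply: regular_ext (@regular_series s k _ (r - 1 - n)) _ => y _.
by rewrite e mulrC !lcoef_tpowM addrAC.
Qed.

Definition chart_coords j n s k (V : set 'rV[F]_k) (x : set M2) : 'rV[F]_k :=
  xget 0 [set v | V v /\ chart j n (series s v) = x].

Lemma series_inj j n s k (v v' : 'rV[F]_k) : n < 0 -> (s + k)%N%:Z = width j n ->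
  chart j n (series s v) = chart j n (series s v') -> v = v'.
Proof.
move=> n0 skw; have s0 : ord_ge 0 (series s v) by apply: ord_geW (@series_ge _ _ _); lia.
move/(chart_eqP _ _ n0 s0) => H; apply/rowP => i.
have := H (s + i)%N; rewrite -skw ltz_nat ltn_add2l ltn_ord => /(_ erefl).
by rewrite lcoefB !lcoef_series => /subr0_eq.
Qed.

(** The offset [s] is [0] for the open locus, where [v_0] must be invertible, and
    [1] for the closed one, where the constant coefficient is zero. *)
Lemma chart_isomorphic j n s k (V : set 'rV[F]_k) (X : set (set M2)) : n < 0 ->
  (s + k)%N%:Z = width j n -> flag_locally_closed X ->
  X = [set chart j n (series s v) | v in V] -> flag_isomorphic X V.
Proof.
move=> n0 skw Xlc XV; split=> //.
have coordsK v : V v -> chart_coords j n s V (chart j n (series s v)) = v.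
  move=> Vv; rewrite /chart_coords; case: xgetP => [v' _ [_ /(series_inj n0 skw)]//|].
  by move=> /(_ v)[].
exists (fun v => chart j n (series s v)), (chart_coords j n s V).
split=> [||v Vv|x].
- exact: morphism_chart.
- move=> m W phi _ phiM phiX i; apply: regular_local => x Wx.
  have [b [g [N [bx gphi _ greg]]]] := phiM x Wx; exists b => //.
  have coords y : (W `&` basic_open b) y -> let v := chart_coords j n s V (phi y) in
      ord_ge 0 (series s v) /\ coset (g y) = chart j n (series s v).
    move=> Uy; have [_ e] := gphi y Uy; split; first by apply: ord_geW (@series_ge _ _ _); lia.
    have : X (phi y) by apply: phiX; exists y => //; case: Uy.
    by rewrite -e XV => -[v Vv <-]; rewrite coordsK.
  have siw : (s + i)%N%:Z < width j n by rewrite -skw ltz_nat ltn_add2l.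
  apply: regular_ext (regular_chart_coef n0 greg coords siw) _ => y _.
  by rewrite lcoef_series.
- by split; [rewrite XV; exists v|exact: coordsK].
by rewrite {1}XV => -[v Vv <-]; rewrite coordsK.
Qed.

Lemma series_cover j n s k c : n < 0 -> (s + k)%N%:Z = width j n -> ord_ge s c ->
  chart j n c = chart j n (series s (\row_(i < k) lcoef c (s + i)%N)).
Proof.
move=> n0 skw cs; apply/chart_eqP => //; first by apply: ord_geW cs; lia.
by rewrite -skw; apply: series_row.
Qed.

Lemma chart_unit_isomorphic j n k : n < 0 -> (1 + k)%N%:Z = width j n ->
  flag_isomorphic (@chart_unit F j n 0) (Gm_affine_space F k).
Proof.
move=> n0 kw; have [lc _] := chart_locally_closed j n0.
apply: (@chart_isomorphic j n 0) => //; apply/seteqP; split=> [_ [c [c0 ce] <-]|_ [v v0 <-]].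
  exists (\row_(i < 1 + k) lcoef c (0 + i)%N); last by rewrite -series_cover.
  by rewrite /Gm_affine_space /= mxE.
exists (series 0 v) => //; split; first exact: series_ge.
by have := lcoef_series 0 v (lshift k ord0); rewrite /= => ->.
Qed.

Lemma chart_ge_isomorphic j n k : n < 0 -> (1 + k)%N%:Z = width j n ->
  flag_isomorphic (@chart_ge F j n 1) (affine_space F k).
Proof.
move=> n0 kw; have [_ lc] := chart_locally_closed j n0.
apply: (@chart_isomorphic j n 1) => //; apply/seteqP; split=> [_ [c c1 <-]|_ [v _ <-]].
  by exists (\row_(i < k) lcoef c (1 + i)%N) => //; rewrite -series_cover.
by exists (series 1 v) => //; apply: series_ge.
Qed.

End ChartIsomorphism.

(** * The symmetry exchanging negative and positive indices *)

Section Symmetry.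
Variable F : fieldType.
Local Notation L := (laurent F).
Local Notation M2 := 'M[laurent F]_2.
Local Notation tpow := (tpow F).
Local Notation base := (base F).
Implicit Types (g h : M2) (c p : L) (j : bool) (n k l : int) (x : set M2).

(** Conjugation by [(0 1; t 0)]. *)
Definition flip g : M2 :=
  mx2 (g 1 1) (tpow (- 1) * g 1 0) (tpow 1 * g 0 1) (g 0 0).

Lemma flipM g h : flip (g *m h) = flip g *m flip h.
Proof.
rewrite [g]mx2_eta [h]mx2_eta mul_mx2 /flip !mx2E mul_mx2.
have t1 a b : (tpow (- 1) * a) * (tpow 1 * b) = a * b.
  by rewrite mulrACA [_ * tpow 1]mulrC tpowK mul1r.
have t2 a b : (tpow 1 * a) * (tpow (- 1) * b) = a * b.
  by rewrite mulrACA tpowK mul1r.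
by congr mx2; rewrite ?t1 ?t2; ring.
Qed.

Lemma flipK g : flip (flip g) = g.
Proof.
have t1 a : tpow (- 1) * (tpow 1 * a) = a by rewrite mulrA [_ * tpow 1]mulrC tpowK mul1r.
have t2 a : tpow 1 * (tpow (- 1) * a) = a by rewrite mulrA tpowK mul1r.
by rewrite /flip !mx2E t1 t2 -mx2_eta.
Qed.

Lemma SL2_flip g : SL2 g -> SL2 (flip g).
Proof.
rewrite [g]mx2_eta /SL2 /flip /= !mx2E !det_mx2 => <-.
by rewrite mulrACA [_ * tpow 1]mulrC tpowK mul1r; ring.
Qed.

Lemma Iwahori_flip g : Iwahori F g -> Iwahori F (flip g).
Proof.
move=> /IwahoriP[gdet [a0 b0 c0 d0]]; apply/IwahoriP; split; first exact: SL2_flip.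
by rewrite /flip !mx2E; split=> //; apply/ord_ge_tpowM.
Qed.

Lemma I2_flip g : I2 F g -> I2 F (flip g).
Proof.
move=> /I2P[gdet [a0 b0 c0 d0]]; apply/I2P; split; first exact: SL2_flip.
by rewrite /flip !mx2E; split=> //; apply/ord_ge_tpowM.
Qed.

Definition flip_set x : set M2 := flip @` x.

Lemma flip_coset g : flip_set (coset g) = coset (flip g).
Proof.
apply/seteqP; split=> [_ [_ [h hI <-] <-]|_ [h hI <-]].
  by exists (flip h); [exact: Iwahori_flip|rewrite flipM].
exists (g *m flip h); last by rewrite flipM flipK.
by exists (flip h) => //; apply: Iwahori_flip.
Qed.

Lemma flip_orbit g :
  flip_set @` flag_orbit (I2 F) (coset g) = flag_orbit (I2 F) (coset (flip g)).
Proof.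
apply/seteqP; split=> [_ [_ /flag_orbit_cosetP[h hI ->] <-]|_ /flag_orbit_cosetP[h hI ->]].
  rewrite flip_coset flipM; apply/flag_orbit_cosetP.
  by exists (flip h) => //; apply: I2_flip.
exists (coset (flip h *m g)); last by rewrite flip_coset flipM flipK.
by apply/flag_orbit_cosetP; exists (flip h) => //; apply: I2_flip.
Qed.

Lemma is_orbit_flip (S : set (set M2)) :
  is_orbit (I2 F) S -> is_orbit (I2 F) (flip_set @` S).
Proof.
move=> [_ [g gdet <-] ->]; exists (coset (flip g)); last exact: flip_orbit.
by exists (flip g) => //; apply: SL2_flip.
Qed.

(** [flip] turns [lower (t c)] into the upper unitriangular matrix with entry [c]
    and the base matrix of index [n] into that of index [- n - j], up to sign. *)
Lemma flip_chart j n c :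
  flip_set (chart j n c) = pt j (- n - j%:Z) (tpow (n + j%:Z) * (- sgn F j * c)).
Proof.
have t1 a : tpow (- 1) * (tpow 1 * a) = a by rewrite mulrA [_ * tpow 1]mulrC tpowK mul1r.
rewrite /chart flip_coset lower_baseE; case: j => /=.
  (* The antidiagonal matrix is mapped to the negative of the one defining
     [ptO], and [-1] belongs to the Iwahori group. *)
  have m1 : Iwahori F (mx2 (- 1) 0 0 (- 1)).
    apply/IwahoriP; rewrite /SL2 /= det_mx2 !mx2E; split; first by ring.
    by split=> //; apply: ord_geN (@ord_ge1 F).
  rewrite -(coset_mulr _ m1) /ptO (_ : - (- n - 1) = n + 1); last by ring.
  rewrite /flip !mx2E mul_mx2 (_ : - n - 1 = - 1 + - n); last by ring.
  by congr coset; congr mx2; rewrite ?tpowD; ring.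
rewrite -[Posz 0]/(0 : int) subr0 addr0 /ptE /flip !mx2E !opprK mulr0 -mulrA t1.
by congr coset; congr mx2; ring.
Qed.

Lemma chart_ltrunc j n c : n < 0 -> ord_ge 0 c ->
  chart j n c = chart j n (ltrunc (width j n) c).
Proof. by move=> n0 c0; apply/chart_eqP => //; apply: ltrunc_sub. Qed.

Lemma lspan_ltrunc k l c : ord_ge k c -> lspan k (l - 1) (ltrunc l c).
Proof.
move=> ck m; rewrite negb_and -!ltNge => /orP[/(ord_ge_ltrunc l ck)//|lm].
by rewrite lcoef_ltrunc ifF //; lia.
Qed.

Lemma lspan_ord_ge k l c : lspan k l c -> ord_ge k c.
Proof. by move=> cs m mk; apply: cs; lia. Qed.

(** As only [c] modulo [t^width] matters, Laurent polynomials suffice as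
    parameters. *)
Lemma chart_ge_span j n k : n < 0 -> 0 <= k ->
  chart_ge j n k = chart j n @` @lspan F k (width j n - 1).
Proof.
move=> n0 k0; apply/seteqP; split=> [_ [c ck <-]|_ [c cs <-]].
  exists (ltrunc (width j n) c); first exact: lspan_ltrunc.
  by rewrite -chart_ltrunc //; apply: ord_geW ck.
by exists c => //; apply: lspan_ord_ge cs.
Qed.

Lemma chart_unit_span j n : n < 0 ->
  chart_unit j n 0 = chart j n @` @lspan_unit F 0 (width j n - 1).
Proof.
move=> n0; apply/seteqP; split=> [_ [c [c0 ce] <-]|_ [c [cs ce] <-]].
  exists (ltrunc (width j n) c); last by rewrite -chart_ltrunc.
  by split; [exact: lspan_ltrunc|rewrite lcoef_ltrunc width_gt0].
by exists c => //; split=> //; apply: lspan_ord_ge cs.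
Qed.

Lemma lcoef_rescale j n c k :
  lcoef (tpow n * (- sgn F j * c)) k = if j then - lcoef c (k - n) else lcoef c (k - n).
Proof.
rewrite lcoef_tpowM /sgn; case: j; first by rewrite mulN1r lcoefN.
by rewrite opprK mul1r.
Qed.

Lemma rescaleK j n p : tpow n * (- sgn F j * (tpow (- n) * (- sgn F j * p))) = p.
Proof.
rewrite /sgn; transitivity (tpow n * tpow (- n) * p); last by rewrite tpowK mul1r.
by case: j; ring.
Qed.

(** Under [flip_chart], the parameters [c] and the Laurent polynomials [p] differ
    by a sign and a power of [t]. *)
Lemma lspan_rescale j n k l :
  [set tpow n * (- sgn F j * c) | c in lspan k l] = lspan (n + k) (n + l).
Proof.
apply/seteqP; split=> [_ [c cs <-] m mkl|p ps].
  rewrite lcoef_rescale [lcoef _ _]cs ?oppr0; first by case: j.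
  by lia.
exists (tpow (- n) * (- sgn F j * p)); last exact: rescaleK.
move=> m mkl; rewrite lcoef_rescale [lcoef _ _]ps ?oppr0; first by case: j.
by lia.
Qed.

Lemma lspan_unit_rescale j n k l :
  [set tpow n * (- sgn F j * c) | c in lspan_unit k l] = lspan_unit (n + k) (n + l).
Proof.
have ce c : (lcoef (tpow n * (- sgn F j * c)) (n + k) != 0) = (lcoef c k != 0).
  by rewrite lcoef_rescale addrAC subrr add0r; case: j; rewrite ?oppr_eq0.
rewrite /lspan_unit -(lspan_rescale j); apply/seteqP; split=> [_ [c [cs c0] <-]|].
  by split; [exists c|rewrite ce].
by move=> _ [[c cs <-]]; rewrite ce => c0; exists c.
Qed.

Lemma flip_chart_unit j n : n < 0 -> [set flip_set x | x in chart_unit j n 0] =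
  pt j (- n - j%:Z) @` lspan_unit (n + j%:Z) (n + j%:Z + (width j n - 1)).
Proof.
move=> n0; have := lspan_unit_rescale j (n + j%:Z) 0 (width j n - 1).
rewrite addr0 => <-; rewrite chart_unit_span // !image_comp.
by apply: eq_imagel => c _ /=; rewrite flip_chart.
Qed.

Lemma flip_chart_ge j n : n < 0 -> [set flip_set x | x in chart_ge j n 1] =
  pt j (- n - j%:Z) @` lspan (n + j%:Z + 1) (n + j%:Z + (width j n - 1)).
Proof.
move=> n0; rewrite chart_ge_span // -(lspan_rescale j) !image_comp.
by apply: eq_imagel => c _ /=; rewrite flip_chart.
Qed.

End Symmetry.

(** * Orbits of both signs *)

Section Orbits.
Variable F : fieldType.
Local Notation tpow := (tpow F).
Implicit Types (j : bool) (n k l : int) (x : set 'M[laurent F]_2).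


Lemma is_orbit_chart_unit (sqrtF : forall a : F, exists b, b ^+ 2 = a) j n :
  n < 0 -> is_orbit (I2 F) (chart_unit j n 0).
Proof.
move=> n0; exists (chart j n 1); first exact: affine_flag_chart.
apply: (chart_unit_orbit sqrtF j n0 (@ord_ge1 F) _).2.
by rewrite lcoef1 oner_eq0.
Qed.

Lemma is_orbit_chart_ge j n : n < 0 -> is_orbit (I2 F) (chart_ge j n 1).
Proof.
move=> n0; exists (pt j n 0); last exact: (@chart_ge1_orbit F j n n0).2.
by rewrite -chart0; apply: affine_flag_chart.
Qed.

Lemma positive_orbits (sqrtF : forall a : F, exists b, b ^+ 2 = a) j n : n < 0 ->
  is_orbit (I2 F)
    (pt j (- n - j%:Z) @` @lspan_unit F (n + j%:Z) (n + j%:Z + (width j n - 1))) /\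
  is_orbit (I2 F)
    (pt j (- n - j%:Z) @` @lspan F (n + j%:Z + 1) (n + j%:Z + (width j n - 1))).
Proof.
move=> n0; rewrite -flip_chart_unit // -flip_chart_ge //.
by split; apply: is_orbit_flip; [exact: is_orbit_chart_unit|exact: is_orbit_chart_ge].
Qed.

(** The open part [So] is the stratum [k = 0] and the closed part [Sh] consists of
    the parameters of positive order, so all assertions are instances of the
    statements about charts. *)
Lemma negative_orbits (sqrtF : forall a : F, exists b, b ^+ 2 = a) j n
    (stratum := fun k => pt (~~ j) (- n - 1 - k) @` @lspan_unit F n (n + width j n - 1 - k))
    (range := [set k | 1 <= k <= width j n - 1])
    (So := pt (~~ j) (- n - 1) @` @lspan_unit F n (n + width j n - 1))
    (Sh := \bigcup_(k in range) stratum k `|` [set pt j n 0]) : n < 0 ->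
  [/\ flag_orbit (Iwahori F) (pt j n 0) = So `|` Sh /\ So `&` Sh = set0,
      is_orbit (I2 F) So /\
        flag_isomorphic So (Gm_affine_space F `|(width j n - 1)%R|%N),
      (trivIset range stratum /\ ~ (\bigcup_(k in range) stratum k) (pt j n 0)) /\
        is_orbit (I2 F) Sh /\
        flag_isomorphic Sh (affine_space F `|(width j n - 1)%R|%N),
      So `<=` flag_orbit (I4 F) (pt (~~ j) (- n - 1) (tpow n))
    & Sh `<=` flag_orbit (I4 F) (pt j n 0)].
Proof.
move=> n0; have w0 := width_gt0 j n0.
have stE k : 0 <= k < width j n -> stratum k = chart_unit j n k.
  exact: stratumE.
have SoE : So = chart_unit j n 0.
  by rewrite -stE ?w0 // /stratum /So !subr0.
have rangeW k : range k -> 0 <= k < width j n by rewrite /range /=; lia.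
have stE1 k : range k -> stratum k = chart_unit j n k by move=> /rangeW/stE.
have ShE : Sh = chart_ge j n 1.
  by rewrite chart_ge_strata // /Sh (eq_bigcupr stE1).
have kw : (1 + `|(width j n - 1)%R|)%N%:Z = width j n by lia.
split.
- rewrite orbit_Iwahori // chart_ge0E SoE ShE; split=> //.
  by apply: chart_unit_ge_disjoint => //; rewrite w0.
- by rewrite SoE; split; [exact: is_orbit_chart_unit|exact: chart_unit_isomorphic].
- rewrite ShE; split; last first.
    by split; [exact: is_orbit_chart_ge|exact: chart_ge_isomorphic].
  have disj k l x : range k -> range l -> k < l -> stratum k x -> stratum l x -> False.
    move=> rk rl kl; rewrite !stE1 // => kx lx.
    have kw' := rangeW k rk.
    have : (chart_unit j n k `&` chart_ge j n (k + 1)) x.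
      by split=> //; apply: chart_unit_sub_ge lx; lia.
    by rewrite chart_unit_ge_disjoint.
  split.
    move=> k l rk rl [x [kx lx]]; have [kl|lk|//] := ltgtP k l.
      by case: (disj k l x rk rl kl kx lx).
    by case: (disj l k x rl rk lk lx kx).
  move=> [k rk]; rewrite stE1 // => kx.
  have kw' := rangeW k rk.
  have : (chart_unit j n k `&` chart_ge j n (k + 1)) (@pt F j n 0).
    by split; [exact: kx|exists 0; [exact: ord_ge0|exact: chart0]].
  by rewrite chart_unit_ge_disjoint.
- have [c [c0 ce] e] : chart_unit j n 0 (pt (~~ j) (- n - 1) (tpow n)).
    rewrite -SoE; exists (tpow n) => //; split; last by rewrite lcoef_tpow eqxx oner_eq0.
    by move=> m mn; rewrite lcoef_tpow; case: eqP => // mE; lia.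
  by rewrite SoE -e; apply: (chart_unit_orbit sqrtF j n0 c0 ce).1.
- by rewrite ShE; apply: (@chart_ge1_orbit F j n n0).1.
Qed.

End Orbits.

Theorem proposition5p1 (R : realType) :
  [/\
    (* (1) *)
    forall n : int, 0 < n ->
      is_orbit (I2 R[i]) (Eo_pos R[i] n) /\ is_orbit (I2 R[i]) (Eh_pos R[i] n),
    (* (2) *)
    (forall n : int, 0 <= n -> is_orbit (I2 R[i]) (Oo_pos R[i] n)) /\
    (forall n : int, 0 < n -> is_orbit (I2 R[i]) (Oh_pos R[i] n)),
    (* (3) *)
    forall n : int, n < 0 ->
      [/\ E_ R[i] n = Eo_neg R[i] n `|` Eh_neg R[i] n /\
            Eo_neg R[i] n `&` Eh_neg R[i] n = set0,
          is_orbit (I2 R[i]) (Eo_neg R[i] n) /\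
            flag_isomorphic (Eo_neg R[i] n)
                            (Gm_affine_space R[i] `|(-2 * n - 1)%R|%N),
          (trivIset (Eh_range n) (Eh_stratum R[i] n) /\
             ~ (\bigcup_(k in Eh_range n) Eh_stratum R[i] n k) (ptE n 0)) /\
            is_orbit (I2 R[i]) (Eh_neg R[i] n) /\
            flag_isomorphic (Eh_neg R[i] n)
                            (affine_space R[i] `|(-2 * n - 1)%R|%N),
          Eo_neg R[i] n `<=` flag_orbit (I4 R[i]) (ptO (- n - 1) (tpow _ n))
        & Eh_neg R[i] n `<=` flag_orbit (I4 R[i]) (ptE n 0)]
  & (* (4) *)
    forall n : int, n < 0 ->
      [/\ O_ R[i] n = Oo_neg R[i] n `|` Oh_neg R[i] n /\
            Oo_neg R[i] n `&` Oh_neg R[i] n = set0,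
          is_orbit (I2 R[i]) (Oo_neg R[i] n) /\
            flag_isomorphic (Oo_neg R[i] n)
                            (Gm_affine_space R[i] `|(-2 * n - 2)%R|%N),
          (trivIset (Oh_range n) (Oh_stratum R[i] n) /\
             ~ (\bigcup_(k in Oh_range n) Oh_stratum R[i] n k) (ptO n 0)) /\
            is_orbit (I2 R[i]) (Oh_neg R[i] n) /\
            flag_isomorphic (Oh_neg R[i] n)
                            (affine_space R[i] `|(-2 * n - 2)%R|%N),
          Oo_neg R[i] n `<=` flag_orbit (I4 R[i]) (ptE (- n - 1) (tpow _ n))
        & Oh_neg R[i] n `<=` flag_orbit (I4 R[i]) (ptO n 0)]].
Proof.
have sqrtF (a : R[i]) : exists b, b ^+ 2 = a by exists (sqrtC a); apply: sqrtCK.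
split=> [n n0||n n0|n n0].
(* The chart of index [m] yields the family of index [- m - j], so [n] comes from
   [- n] for [E_n] and from [- n - 1] for [O_n]. *)
- have m0 : - n < 0 by lia.
  have := positive_orbits sqrtF false m0; rewrite /Eo_pos /Eh_pos /width.
  rewrite (_ : - - n - false%:Z = n); last by rewrite /=; lia.
  rewrite (_ : - n + false%:Z = - n); last by rewrite /=; lia.
  by rewrite (_ : - n + (- 2 * - n - false%:Z - 1) = n - 1); last by rewrite /=; lia.
- have H n : 0 <= n ->
      is_orbit (I2 R[i]) (Oo_pos R[i] n) /\ is_orbit (I2 R[i]) (Oh_pos R[i] n).
    move=> n0; have m0 : - n - 1 < 0 by lia.
    have := positive_orbits sqrtF true m0; rewrite /Oo_pos /Oh_pos /width.
    rewrite (_ : - (- n - 1) - true%:Z = n); last by rewrite /=; lia.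
    rewrite (_ : - n - 1 + true%:Z = - n); last by rewrite /=; lia.
    by rewrite (_ : - n + (- 2 * (- n - 1) - true%:Z - 1) = n); last by rewrite /=; lia.
  by split=> n n0; [case: (H n n0)|case: (H n (ltW n0))].
- have := negative_orbits sqrtF false n0; rewrite /width /=.
  rewrite (_ : - 2 * n - 0%N%:Z - 1 = - 2 * n - 1); last by lia.
  rewrite (_ : n + (- 2 * n - 0%N%:Z) - 1 = - n - 1); last by lia.
  exact.
have := negative_orbits sqrtF true n0; rewrite /width /=.
rewrite (_ : - 2 * n - 1%N%:Z - 1 = - 2 * n - 2); last by lia.
rewrite (_ : n + (- 2 * n - 1%N%:Z) - 1 = - n - 2); last by lia.
exact.
Qed.
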